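(* Let $f=f_n:\{0,1\}^{3^n}\to\{0,1\}$ be the iterated 3-majority function on the rooted ternary tree of depth $n$. Let $\gamma_n=n^{\alpha}$ for a constant $\alpha$ and let $p_n=\frac12-\gamma_n\left(\frac23\right)^n$ (for all $n$ large enough that $p_n\in[0,1]$). Let $\alpha_0:=\log(3/2)/\log 2$. If $\alpha>\alpha_0$, then $\{f_n\}$ is lame with respect to $\{p_n\}$, and if $\alpha<\alpha_0$, then $\{f_n\}$ is volatile with respect to $\{p_n\}$.
   Context: Iterated 3-majority: let $\mathbb{T}_n$ be the rooted ternary tree of depth $n$ (every non-leaf vertex has three children; there are $3^n$ leaves). Given states $Y_l\in\{0,1\}$ at the leaves $l$, the states of the other vertices are defined recursively by $Y_u=\max(Y_{v_1}Y_{v_2},Y_{v_1}Y_{v_3},Y_{v_2}Y_{v_3})$, where $v_1,v_2,v_3$ are the children of $u$ (i.e. the majority of the children's states). Then $f_n(Y)=Y_o$, where $o$ is the root. Dynamics: $X^{(n)}(t)=(X^{(n)}_1(t),\dots,X^{(n)}_{3^n}(t))$, $t\ge0$, where the coordinates (leaf variables) are independent stationary continuous-time Markov chains on $\{0,1\}$ jumping from $0$ to $1$ at rate $p_n$ and from $1$ to $0$ at rate $1-p_n$ (so each is $1$ with probability $p_n$ at any fixed time). $C_n$ is the number of times $f_n(X^{(n)}(t))$ changes state during $[0,1]$. The sequence is lame with respect to $\{p_n\}$ if $\lim_{n\to\infty}\mathbb{P}(C_n=0)=1$, and volatile with respect to $\{p_n\}$ if $C_n\to\infty$ in distribution, i.e.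 $\mathbb{P}(C_n\ge M)\to1$ for every $M$. *)

(* Defs.v *)
From HB Require Import structures.
From mathcomp Require Import all_boot all_order all_algebra.
From mathcomp Require Import all_classical all_reals all_analysis.
Set Implicit Arguments.
Unset Strict Implicit.
Unset Printing Implicit Defensive.
Import Order.TTheory GRing.Theory Num.Theory.
Import numFieldNormedType.Exports.
Local Open Scope classical_set_scope.
Local Open Scope ring_scope.

(** Iterated 3-majority. *)

(* A leaf of the ternary tree of depth n is the word of the child choices made
   on the way down from the root. *)
Definition leaf (n : nat) : finType := n.-tuple 'I_3.

Lemma card_leaf n : #|leaf n| = (3 ^ n)%N.
Proof. by rewrite card_tuple card_ord. Qed.

(* On booleans this is max(ab, ac, bc). *)
Definition maj3 (a b c : bool) : bool := [|| a && b, a && c | b && c].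

(* The state of the root: the subtree hanging from the i-th child of the root
   has as leaves the words starting with i. *)
Fixpoint iter_maj3 (n : nat) : (leaf n -> bool) -> bool :=
  match n return (leaf n -> bool) -> bool with
  | 0 => fun Y => Y [tuple]
  | m.+1 => fun Y =>
      let child (i : 'I_3) := iter_maj3 (fun l : leaf m => Y (cons_tuple i l)) in
      maj3 (child (inord 0)) (child (inord 1)) (child (inord 2))
  end.

(** Two-state continuous-time Markov chains. *)

(* Rate of leaving x: 0 -> 1 at rate p, 1 -> 0 at rate 1 - p. *)
Definition flip_rate (R : realType) (p : R) (x : bool) : R :=
  if x then 1 - p else p.

(* K is the transition semigroup of the chain on {0,1} that jumps from x to
   ~~ x at rate q x; the diagonal of the generator is determined by the row
   sums. *)
Record transition_semigroup (R : realType) (q : bool -> R)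
    (K : R -> bool -> bool -> R) : Prop := {
  trans_ge0 : forall t x y, 0 <= t -> 0 <= K t x y ;
  trans_sum1 : forall t x, 0 <= t -> \sum_(y : bool) K t x y = 1 ;
  trans_0 : forall x y, K 0 x y = (x == y)%:R ;
  trans_semigroup : forall s t x y, 0 <= s -> 0 <= t ->
    K (s + t) x y = \sum_(z : bool) K s x z * K t z y ;
  trans_rate : forall x, h^-1 * K h x (~~ x) @[h --> 0^'+] --> q x }.

(* Processes are indexed by all of R, but only times t >= 0 matter. *)
Section Process.
Context (R : realType) (d : measure_display) (T : measurableType d).
Context (P : probability T R).

Definition cadlag (g : R -> bool) : Prop :=
  (forall t, 0 <= t -> \forall s \near t^'+, g s = g t) /\
  (forall t, 0 < t -> exists b, \forall s \near t^'-, g s = b).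

Record markov_chain (q : bool -> R) (Y : R -> T -> bool) : Prop := {
  mc_measurable : forall t, 0 <= t -> measurable_fun [set: T] (Y t) ;
  mc_cadlag : forall w, cadlag (Y ^~ w) ;
  mc_markov : exists2 K, transition_semigroup q K &
    forall (k : nat) (t : nat -> R) (x : nat -> bool),
      0 <= t 0%N -> (forall i, t i < t i.+1) ->
      P [set w | forall i, (i <= k.+1)%N -> Y (t i) w = x i] =
      (P [set w | forall i, (i <= k)%N -> Y (t i) w = x i] *
       (K (t k.+1 - t k) (x k) (x k.+1))%:E)%E }.

Definition stationary (Y : R -> T -> bool) : Prop :=
  forall (k : nat) (t : 'I_k -> R) (x : 'I_k -> bool) (s : R),
    (forall i, 0 <= t i) -> 0 <= s ->
    P [set w | forall i, Y (t i + s) w = x i] =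
    P [set w | forall i, Y (t i) w = x i].

Definition sigma_process (Y : R -> T -> bool) : set (set T) :=
  <<s [set A | exists2 t, 0 <= t & exists B : set bool, A = Y t @^-1` B] >>.

Definition independent_processes (I : finType) (X : I -> R -> T -> bool) :=
  forall A : I -> set T, (forall i, sigma_process (X i) (A i)) ->
  forall J : {set I},
    P (\bigcap_(i in [set` J]) A i) = (\prod_(i in J) P (A i))%E.

Record independent_stationary_flips (I : finType) (p : R)
    (X : I -> R -> T -> bool) : Prop := {
  flips_markov : forall i, markov_chain (flip_rate p) (X i) ;
  flips_stationary : forall i, stationary (X i) ;
  flips_independent : independent_processes X }.

End Process.

(** Number of changes, lameness and volatility. *)

(* The value jumps at time t: it differs from the left limit. *)
Definition change_times (R : realType) (g : R -> bool) : set R :=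
  [set t | 0 < t <= 1 /\ \forall s \near t^'-, g s != g t].

Definition num_changes (R : realType) (T I : Type) (f : (I -> bool) -> bool)
    (X : I -> R -> T -> bool) (w : T) : \bar R :=
  counting (change_times (fun t => f (fun i => X i t w))).

Definition lame (R : realType) (d : nat -> measure_display)
    (T : forall n, measurableType (d n)) (P : forall n, probability (T n) R)
    (C : forall n, T n -> \bar R) : Prop :=
  P n [set w | C n w = 0%E] @[n --> \oo] --> 1%E.

Definition volatile (R : realType) (d : nat -> measure_display)
    (T : forall n, measurableType (d n)) (P : forall n, probability (T n) R)
    (C : forall n, T n -> \bar R) : Prop :=
  forall M : nat, P n [set w | (M%:R%:E <= C n w)%E] @[n --> \oo] --> 1%E.

(** The parameters. *)

Definition maj3_prob (R : realType) (alpha : R) (n : nat) : R :=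
  2^-1 - n%:R `^ alpha * (2 / 3) ^+ n.

Definition alpha0 (R : realType) : R := ln (3 / 2) / ln 2.

(* Main.v *)
(* Write q_j for the probability that a vertex at height j is 1, v_j = 4 q_j (1 - q_j),
   and rho_j(s) for the correlation of its states at two times s apart, so that
   rho_0(s) = e^{-s}. All three satisfy explicit recursions:
     q' = q^2 (3 - 2 q),   v' = v^2 (3 + v) / 4,
     rho' = rho (3 v + 3 (1 - v) rho + v rho^2) / (3 + v).
   While q is close to 1/2, 1/2 - q grows by the factor 3/2 per level, so for
   alpha > 0 about alpha log_{3/2} n levels are left once it is of order 1; on those
   v is essentially squared, and log (1 / v_n) is of order n^(alpha / alpha0).
   Lame: 1 - rho' <= 2 (1 - rho), so a union bound over a grid of N times bounds the
   probability of a change by 2^n v_n uniformly in N, and v_n <= 4^{-n} when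
   alpha > alpha0.
   Volatile: rho / (1 - rho) shrinks by 3/4 per level, so states at times at least h
   apart have correlation at most (3/4)^n / h. When alpha < alpha0, 1 / v_n is
   subexponential, and the second moment method shows that both states occur in
   each of K blocks of exponentially many equally spaced times, with probability
   tending to 1. *)

Require Import Defs.
From HB Require Import structures.
From mathcomp Require Import all_boot all_order all_algebra.
From mathcomp Require Import all_classical all_reals all_analysis.
From mathcomp Require Import ring lra.
Import Order.TTheory GRing.Theory Num.Theory.
Import numFieldNormedType.Exports.
Local Open Scope classical_set_scope.
Local Open Scope ring_scope.
Set Implicit Arguments.
Unset Strict Implicit.
Unset Printing Implicit Defensive.

(** * The recursion for mean and correlation *)

Section Recursion.
Context {R : realType}.
Implicit Types (q c rho : R).

Definition maj_mean q : R := q ^+ 2 * (3 - 2 * q).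

(* The variance, normalised to be [1] at [q = 1/2]. *)
Definition nvar q : R := 4 * q * (1 - q).

Definition maj_corr q rho : R :=
  rho * (3 * nvar q + 3 * (1 - nvar q) * rho + nvar q * rho ^+ 2) /
  (3 + nvar q).

Lemma nvar_maj_mean q : nvar (maj_mean q) = nvar q ^+ 2 * (3 + nvar q) / 4.
Proof. by rewrite /nvar /maj_mean; field. Qed.

Lemma nvar_bound q : 0 <= q <= 1 -> 0 <= nvar q <= 1.
Proof.
rewrite /nvar => /andP[q0 q1]; have := sqr_ge0 (1 - 2 * q).
have := mulr_ge0 q0 (_ : 0 <= 1 - q); rewrite subr_ge0 => /(_ q1) *.
by apply/andP; split; lra.
Qed.

Lemma maj_mean_bound q : 0 <= q <= 1 / 2 -> 0 <= maj_mean q <= 1 / 2.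
Proof.
rewrite /maj_mean => /andP[q0 q1]; apply/andP; split.
  by rewrite mulr_ge0 ?exprn_ge0 //; lra.
have : 0 <= (1 / 2 - q) * (1 + 2 * q * (1 - q)) by apply: mulr_ge0; nra.
lra.
Qed.

Lemma half_sub_maj_mean q :
  1 / 2 - maj_mean q = (1 / 2 - q) * (1 + nvar q / 2).
Proof. by rewrite /nvar /maj_mean; field. Qed.

(** In centred bits, majority has coefficients [2 * q * (1 - q)], [1 - 2 * q] and [- 2] on the three
    monomials of degree 1, the three of degree 2 and the one of degree 3. Squaring them and
    weighting degree k by the k-th power of the leaf covariance [q * (1 - q) * rho] gives the left
    side. *)
Lemma maj_cov_corr q rho : 0 <= q <= 1 ->
  12 * (q * (1 - q)) ^+ 2 * (q * (1 - q) * rho)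
  + 3 * (1 - 2 * q) ^+ 2 * (q * (1 - q) * rho) ^+ 2
  + 4 * (q * (1 - q) * rho) ^+ 3
  = maj_mean q * (1 - maj_mean q) * maj_corr q rho.
Proof.
move=> q01; have := nvar_bound q01; rewrite /maj_corr /maj_mean /nvar => vb.
by field; apply/eqP; lra.
Qed.

Lemma maj_corr_bound q rho : 0 <= q <= 1 -> 0 <= rho <= 1 ->
  0 <= maj_corr q rho <= 1.
Proof.
move=> /nvar_bound; rewrite /maj_corr; move: (nvar q) => v vb rb.
apply/andP; split.
  by apply: divr_ge0; [apply: mulr_ge0; nra|lra].
rewrite ler_pdivrMr; last lra.
have r2 : rho ^+ 2 <= 1 by nra.
have h : 3 * v + 3 * (1 - v) * rho + v * rho ^+ 2 <= 3 + v by nra.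
nra.
Qed.

(** As a polynomial in [rho] with nonnegative coefficients, [maj_corr q] is convex on [0,1]. At
    [rho = 1] it has value 1 and slope [6 / (3 + nvar q)]; this is at most 2 only up to the factor
    [3 / (3 + nvar q)], so the tangent there gives the bound. *)
Lemma maj_corr_decorrelates q rho : 0 <= q <= 1 -> 0 <= rho <= 1 ->
  1 - maj_corr q rho <= 2 * (1 - rho).
Proof.
move=> /nvar_bound; rewrite /maj_corr; move: (nvar q) => v vb rb.
rewrite lerBlDr -lerBlDl ler_pdivlMr; last lra.
have -> : rho * (3 * v + 3 * (1 - v) * rho + v * rho ^+ 2) =
  (1 - 2 * (1 - rho)) * (3 + v) +
  (1 - rho) * ((3 + v) * 2 - (3 * v + 3 * (1 - v) * (1 + rho)
                 + v * (1 + rho + rho ^+ 2))) by ring.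
rewrite lerDl mulr_ge0 //; first lra.
have : 0 <= v * (1 + 2 * rho - rho ^+ 2) by apply: mulr_ge0; nra.
lra.
Qed.

(* The ratio [rho / (1 - rho)] shrinks by [3/4] at each level: [v] only
   averages [(3 + rho^2) / 4] with [rho], which is the smaller of the two. *)
Lemma maj_corr_contracts A q rho : 0 <= q <= 1 -> 0 <= rho <= 1 ->
  0 <= A -> rho <= A * (1 - rho) ->
  maj_corr q rho <= 3 / 4 * A * (1 - maj_corr q rho).
Proof.
move=> q01 rb A0 rA.
(* [s] is the value of [maj_corr] at [q = 1/2], the worst case; there [1 - s = (1 - rho) * (4 + rho
   + rho ^+ 2) / 4]. *)
set s := rho * (3 + rho ^+ 2) / 4.
have le_s : maj_corr q rho <= s.
  move: (nvar_bound q01); rewrite /maj_corr /s; move: (nvar q) => v vb.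
  rewrite ler_pdivrMr; last lra.
  have -> : rho * (3 + rho ^+ 2) / 4 * (3 + v) =
    rho * (3 * v + 3 * (1 - v) * rho + v * rho ^+ 2) +
    rho * (1 - v) * (3 / 4) * (1 - rho) * (3 - rho) by field.
  rewrite lerDl; do 2 (apply: mulr_ge0; last lra).
  by apply: mulr_ge0; last lra; apply: mulr_ge0; lra.
have : s <= 3 / 4 * A * (1 - s).
  have -> : 3 / 4 * A * (1 - s) =
    3 / 16 * (A * (1 - rho)) * (4 + rho + rho ^+ 2) by rewrite /s; field.
  apply: (@le_trans _ _ (3 / 16 * rho * (4 + rho + rho ^+ 2))); last first.
    by rewrite ler_pM2r ?ler_pM2l //; nra.
  rewrite /s; suff: 0 <= rho * (rho * (3 - rho)) by lra.
  by apply: mulr_ge0; [lra|apply: mulr_ge0; lra].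
have : 3 / 4 * A * (1 - s) <= 3 / 4 * A * (1 - maj_corr q rho).
  by rewrite ler_wpM2l //; lra.
lra.
Qed.

(** * Iteration over the levels of the tree *)

Context (p : R).
Hypothesis p_bound : 0 <= p <= 1 / 2.

Definition root_mean n := iter n maj_mean p.

Fixpoint root_corr rho n : R :=
  if n is m.+1 then maj_corr (root_mean m) (root_corr rho m) else rho.

Lemma root_mean_bound n : 0 <= root_mean n <= 1 / 2.
Proof. by elim: n => //= n; exact: maj_mean_bound. Qed.

Lemma root_mean_bound1 n : 0 <= root_mean n <= 1.
Proof. by have := root_mean_bound n; lra. Qed.

Lemma root_nvar_bound n : 0 <= nvar (root_mean n) <= 1.
Proof. exact/nvar_bound/root_mean_bound1. Qed.

Lemma root_corr_bound rho n : 0 <= rho <= 1 -> 0 <= root_corr rho n <= 1.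
Proof.
move=> rb; elim: n => //= n; apply: maj_corr_bound.
exact: root_mean_bound1.
Qed.

Lemma root_corr_decorrelates rho n : 0 <= rho <= 1 ->
  1 - root_corr rho n <= 2 ^+ n * (1 - rho).
Proof.
move=> rb; elim: n => [|n IH] /=; first by rewrite expr0 mul1r.
apply: le_trans (maj_corr_decorrelates (root_mean_bound1 n)
  (root_corr_bound n rb)) _.
by rewrite exprS -mulrA ler_pM2l.
Qed.

Lemma root_corr_contracts A rho n : 0 <= rho <= 1 -> 0 <= A ->
  rho <= A * (1 - rho) -> root_corr rho n <= (3 / 4) ^+ n * A.
Proof.
move=> rb A0 rA.
have An m : 0 <= (3 / 4) ^+ m * A by rewrite mulr_ge0 // exprn_ge0 //; lra.
(* The induction carries the ratio form; the factor [1 - root_corr rho n] is dropped only at the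
   end. *)
suff : root_corr rho n <= (3 / 4) ^+ n * A * (1 - root_corr rho n).
  move=> /le_trans; apply; rewrite ler_piMr //.
  by have := root_corr_bound n rb; lra.
elim: n => [|n IH] /=; first by rewrite expr0 mul1r.
rewrite exprS -(mulrA (3 / 4) _ A).
exact: maj_corr_contracts (root_mean_bound1 n) (root_corr_bound n rb) (An n) IH.
Qed.

(* Dividing by [nvar] linearises the escape from [1/2]: the ratio
   [(1/2 - q) / nvar q] grows by a factor [3/2] at least, without any loss. *)
Lemma root_mean_escape n : 0 <= 1 / 2 - p ->
  (3 / 2) ^+ n * (1 / 2 - p) * nvar (root_mean n) <= 1 / 2 - root_mean n.
Proof.
move=> e0; elim: n => [|n IH].
  rewrite expr0 mul1r ler_piMr //.
  by have := root_nvar_bound 0; lra.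
rewrite /= half_sub_maj_mean nvar_maj_mean.
have := root_mean_bound n; have := root_nvar_bound n.
set B := (3 / 2) ^+ n * (1 / 2 - p) in IH *.
move: (root_mean n) (nvar (root_mean n)) IH => q v IH vb qb.
have B0 : 0 <= B by rewrite mulr_ge0 // exprn_ge0 //; lra.
have -> : (3 / 2) ^+ n.+1 * (1 / 2 - p) * (v ^+ 2 * (3 + v) / 4) =
  B * v * (3 / 8 * v * (3 + v)) by rewrite /B exprS; field.
apply: le_trans (_ : (1 / 2 - q) * (3 / 8 * v * (3 + v)) <= _).
  by rewrite ler_wpM2r //; nra.
rewrite ler_wpM2l //; first lra.
nra.
Qed.

(** After [J] levels the escape estimate gives [nvar <= 1/2 - q <= 1/2]. From there on
    [v ^+ 2 * (3 + v) / 4 <= v ^+ 2], so each of the [r] remaining levels squares the bound. *)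
Lemma root_nvar_halves n J r : (n = J + r)%N ->
  1 <= (3 / 2) ^+ J * (1 / 2 - p) -> nvar (root_mean n) <= (1 / 2) ^+ (2 ^ r).
Proof.
move=> -> BJ; elim: r => [|r IH].
  rewrite addn0 expn0 expr1.
  have e0 : 0 <= 1 / 2 - p by move: p_bound; lra.
  have := root_mean_escape J e0; have := root_mean_bound J.
  have : nvar (root_mean J) <= (3 / 2) ^+ J * (1 / 2 - p) * nvar (root_mean J).
    by rewrite ler_peMl //; have := root_nvar_bound J; lra.
  lra.
rewrite addnS /= nvar_maj_mean expnS mulnC exprM.
have := root_nvar_bound (J + r).
have : nvar (root_mean (J + r)) ^+ 2 <= ((1 / 2) ^+ (2 ^ r)) ^+ 2.
  by rewrite lerXn2r // nnegrE; [have := root_nvar_bound (J + r); lra|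
    apply: exprn_ge0; lra].
move: (nvar (root_mean (J + r))) ((1 / 2) ^+ (2 ^ r)) => v w *; nra.
Qed.

Lemma root_mean_grows n : 1 / 2 - root_mean n <= (3 / 2) ^+ n * (1 / 2 - p).
Proof.
elim: n => [|n IH]; first by rewrite expr0 !mul1r.
rewrite /= half_sub_maj_mean exprS -mulrA.
by have := root_nvar_bound n; have := root_mean_bound n; nra.
Qed.

Lemma root_nvar_lower n J r : (n = J + r)%N ->
  (3 / 2) ^+ J * (1 / 2 - p) <= 1 / 4 ->
  (1 / 2) ^+ (2 ^ r) <= nvar (root_mean n).
Proof.
move=> -> BJ.
have base : 3 / 4 <= nvar (root_mean J).
  have := root_mean_grows J; have := root_mean_bound J.
  rewrite /nvar; move: (root_mean J) => q *; nra.
(* Since the next variance is at least [3 / 4 * v ^+ 2], the quantity [3 / 4 * v] at least squares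
   at each level. It starts from at least 9/16, which exceeds 1/2. *)
suff : (9 / 16) ^+ (2 ^ r) <= 3 / 4 * nvar (root_mean (J + r)).
  have : (1 / 2 : R) ^+ (2 ^ r) <= (9 / 16) ^+ (2 ^ r).
    by rewrite lerXn2r // ?nnegrE; lra.
  have := root_nvar_bound (J + r); lra.
elim: r => [|r IH]; first by rewrite addn0 expn0 expr1; lra.
rewrite addnS /= nvar_maj_mean expnS mulnC exprM.
have w0 : 0 <= (9 / 16 : R) ^+ (2 ^ r) by apply: exprn_ge0; lra.
have := root_nvar_bound (J + r).
move: (nvar (root_mean (J + r))) ((9 / 16) ^+ (2 ^ r)) IH w0 => v w IH w0 vb.
have : w ^+ 2 <= (3 / 4 * v) ^+ 2 by rewrite lerXn2r // nnegrE; lra.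
nra.
Qed.

End Recursion.

(** * Asymptotics of the variance at the root *)

Section Threshold.
Context {R : realType}.
Implicit Types (alpha : R) (n : nat).

(** [alpha0] is the solution of [2 ^ alpha0 = 3/2]: [r] squaring levels with [2 ^ r] of order n
    offset a factor of order [n ^ alpha0] in the escape from 1/2. *)
Lemma powR2_alpha0 r : ((2 ^ r)%:R : R) `^ alpha0 R = (3 / 2) ^+ r.
Proof.
rewrite natrX -powR_mulrn // -powRrM mulrC powRrM.
have -> : (2 : R) `^ alpha0 R = 3 / 2.
  rewrite /powR pnatr_eq0 /= /alpha0 divfK ?lnK // ?posrE ?divr_gt0 ?ltr0n //.
  by rewrite gt_eqF // ln_gt0 // ltr1n.
by rewrite powR_mulrn; last lra.
Qed.

Lemma near_powR_ge (a b : R) : 0 < a -> \forall n \near \oo, b <= n%:R `^ a.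
Proof.
move=> a0; have := nbhs_infty_ger (`|b| `^ a^-1).
apply: filterS => n bn; apply: le_trans (ler_norm b) _.
have -> : `|b| = (`|b| `^ a^-1) `^ a.
  by rewrite -powRrM mulVf ?gt_eqF // powRr1.
by apply: ge0_ler_powR; rewrite ?nnegrE ?powR_ge0 //; exact: ltW.
Qed.

(** The power is bounded by [n ^ k] for an integer [k] above [|alpha|], the geometric term from
    below by the term of degree [k + 1] in the series of [expR (n * l)]; the spare factor n absorbs
    the constants. *)
Lemma near_powR_le_geometric alpha :
  \forall n \near \oo, 2 * n%:R `^ alpha <= (3 / 2 : R) ^+ n.
Proof.
pose k := Num.Def.archi_bound `|alpha|.
pose l : R := ln (3 / 2).
have l0 : 0 < l by apply: ln_gt0; lra.
pose c := l ^+ k.+1 / (k.+1)`!%:R.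
have c0 : 0 < c by rewrite divr_gt0 ?exprn_gt0 // ltr0n fact_gt0.
near=> n.
have n1 : (1 : R) <= n%:R by near: n; exact: nbhs_infty_ger.
have nc : 2 / c <= n%:R by near: n; exact: nbhs_infty_ger.
have : n%:R `^ alpha <= n%:R ^+ k.
  rewrite -powR_mulrn; last lra.
  by apply: ler_powR => //; by apply: le_trans (ler_norm _) (ltW (archi_boundP _)).
have -> : (3 / 2 : R) ^+ n = expR (n%:R * l).
  by rewrite expRM_natl lnK // posrE; lra.
have := @expR_ge1Dxn R (n%:R * l) k (mulr_ge0 (ler0n _ _) (ltW l0)).
have -> : (n%:R * l) ^+ k.+1 / (k.+1)`!%:R = (n%:R * c) * n%:R ^+ k.
  by rewrite exprMn exprS /c; ring.
move: nc; rewrite ler_pdivrMr // => nc h1 h2.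
have : 2 * n%:R ^+ k <= n%:R * c * n%:R ^+ k by rewrite ler_wpM2r ?exprn_ge0.
lra.
Unshelve. all: by end_near.
Qed.

Lemma half_sub_maj3_prob alpha n :
  1 / 2 - maj3_prob alpha n = n%:R `^ alpha * (2 / 3) ^+ n.
Proof. by rewrite /maj3_prob; lra. Qed.

(** Comparing the deviation from 1/2 after [J] levels with a constant thus amounts to comparing
    [(3 / 2) ^+ r] with the power of n. *)
Lemma expr32_split alpha n J r : (n = J + r)%N ->
  (3 / 2) ^+ J * (1 / 2 - maj3_prob alpha n) * (3 / 2) ^+ r = n%:R `^ alpha.
Proof.
move=> nJr; rewrite half_sub_maj3_prob mulrAC -exprD -nJr mulrCA -exprMn.
by rewrite (_ : 3 / 2 * (2 / 3) = 1 :> R) ?expr1n ?mulr1 //; field.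
Qed.

Lemma maj3_prob_le_half alpha n : maj3_prob alpha n <= 1 / 2.
Proof.
rewrite -subr_ge0 half_sub_maj3_prob mulr_ge0 ?powR_ge0 // exprn_ge0 //; lra.
Qed.

Lemma near_maj3_prob_bound alpha :
  \forall n \near \oo, 0 <= maj3_prob alpha n <= 1 / 2.
Proof.
near=> n; rewrite maj3_prob_le_half andbT.
have h : 2 * n%:R `^ alpha <= (3 / 2 : R) ^+ n.
  by near: n; exact: near_powR_le_geometric.
have := half_sub_maj3_prob alpha n.
have : 2 * (n%:R `^ alpha) * (2 / 3) ^+ n <= 1.
  apply: le_trans (_ : (3 / 2) ^+ n * (2 / 3) ^+ n <= _).
    by rewrite ler_wpM2r // exprn_ge0 //; lra.
  by rewrite -exprMn (_ : 3 / 2 * (2 / 3) = 1 :> R) ?expr1n //; field.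
lra.
Unshelve. all: by end_near.
Qed.

Lemma near_root_nvar_small alpha : alpha0 R < alpha ->
  \forall n \near \oo,
    nvar (root_mean (maj3_prob alpha n) n) <= (1 / 4) ^+ n.
Proof.
move=> ha; near=> n.
have p_bound : 0 <= maj3_prob alpha n <= 1 / 2.
  by near: n; exact: near_maj3_prob_bound.
have n0 : (0 < n)%N by near: n; exact: nbhs_infty_gt.
have a0 : 0 < alpha0 R by rewrite divr_gt0 // ln_gt0 //; lra.
(* This [r] gives [2 * n <= 2 ^ r <= 4 * n]. The lower half turns [(1 / 2) ^+ (2 ^ r)] into
   [(1 / 4) ^+ n]; the upper half keeps [(3 / 2) ^+ r] below the power of n because
   [alpha0 < alpha]. *)
pose t := trunc_log 2 n; pose r := t.+2.
have two_r : (2 * n <= 2 ^ r)%N.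
  by rewrite expnS leq_mul2l /= ltnW // trunc_log_ltn.
have r_two : (2 ^ r <= 4 * n)%N by rewrite !expnS mulnA (leq_mul2l 4) trunc_logP.
have r_pow : (3 / 2) ^+ r <= n%:R `^ alpha.
  rewrite -powR2_alpha0.
  apply: le_trans (_ : (4 * n)%:R `^ alpha0 R <= _).
    by apply: ge0_ler_powR; rewrite ?nnegrE ?ler_nat // ltW.
  rewrite natrM powRM // -[leRHS](_ : n%:R `^ (alpha - alpha0 R) * n%:R `^ alpha0 R = _).
    rewrite ler_wpM2r ?powR_ge0 //; near: n.
    by apply: near_powR_ge; rewrite subr_gt0.
  by rewrite -powRD ?subrK // pnatr_eq0 -lt0n n0 implybT.
have r_le_n : (r <= n)%N.
  rewrite -(@ler_eXn2l R (3 / 2)); last lra.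
  apply: le_trans r_pow (le_trans _ (_ : 2 * n%:R `^ alpha <= _)).
    by rewrite ler_peMl ?powR_ge0 // ler1n.
  by near: n; exact: near_powR_le_geometric.
have nJr : (n = n - r + r)%N by rewrite subnK.
apply: le_trans (root_nvar_halves p_bound nJr _) _.
  rewrite -(ler_pM2r (_ : 0 < (3 / 2) ^+ r)); last by apply: exprn_gt0; lra.
  by rewrite (expr32_split alpha nJr) mul1r.
apply: le_trans (_ : (1 / 2) ^+ (2 * n) <= _).
  by rewrite ler_wiXn2l //; lra.
rewrite exprM le_eqVlt; apply/orP; left; apply/eqP; congr (_ ^+ _).
by field.
Unshelve. all: by end_near.
Qed.

Lemma near_root_nvar_large alpha : alpha < alpha0 R ->
  \forall n \near \oo,
    (1 / 2) ^+ (n %/ 16) <= nvar (root_mean (maj3_prob alpha n) n).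
Proof.
move=> ha; near=> n.
have p_bound : 0 <= maj3_prob alpha n <= 1 / 2.
  by near: n; exact: near_maj3_prob_bound.
have n16 : (16 <= n)%N by near: n; exact: nbhs_infty_ge.
have n0 : (0 < n)%N by exact: leq_trans n16.
have a0 : 0 < alpha0 R by rewrite divr_gt0 // ln_gt0 //; lra.
(* Now [2 ^ r <= n / 16] gives the claimed exponent, while [n <= 32 * 2 ^ r] makes [(3 / 2) ^+ r] of
   order at least [n ^ alpha0], which eventually beats four times the power of n. *)
pose k := (n %/ 16)%N; pose r := trunc_log 2 k.
have k0 : (0 < k)%N by rewrite divn_gt0.
have r_two : (2 ^ r <= k)%N by rewrite trunc_logP.
have two_r : (n <= 32 * 2 ^ r)%N.
  rewrite (_ : (32 * 2 ^ r) = 2 ^ r.+1 * 16)%N; last by rewrite expnS mulnAC.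
  by apply: ltnW; rewrite -ltn_divLR // trunc_log_ltn.
have r_pow : 4 * n%:R `^ alpha <= (3 / 2) ^+ r.
  rewrite -powR2_alpha0 -(ler_pM2l (_ : 0 < 32 `^ alpha0 R)) ?powR_gt0 //.
  rewrite -powRM // -natrM.
  apply: le_trans (_ : n%:R `^ alpha0 R <= _); last first.
    by apply: ge0_ler_powR; rewrite ?nnegrE ?ler_nat // ltW.
  rewrite -[leRHS](_ : n%:R `^ (alpha0 R - alpha) * n%:R `^ alpha = _).
    rewrite mulrA ler_wpM2r ?powR_ge0 //; near: n.
    by apply: near_powR_ge; rewrite subr_gt0.
  by rewrite -powRD ?subrK // pnatr_eq0 -lt0n n0 implybT.
have r_le_n : (r <= n)%N.
  by apply: leq_trans (ltnW (ltn_expl r (isT : 1 < 2)%N)) (leq_trans r_two (leq_div _ _)).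
have nJr : (n = n - r + r)%N by rewrite subnK.
apply: le_trans (root_nvar_lower p_bound nJr _).
  by rewrite ler_wiXn2l //; lra.
rewrite -(ler_pM2r (_ : 0 < (3 / 2) ^+ r)); last by apply: exprn_gt0; lra.
rewrite (expr32_split alpha nJr); lra.
Unshelve. all: by end_near.
Qed.

End Threshold.

(** * Joint law of the root at two times *)

Section PairLaw.
Context {R : realType}.
Implicit Types (q : R).

(* Joint law of two [0/1] variables of mean [q] and covariance [c]. *)
Definition pair_law q (c : R) (x : bool * bool) : R :=
  (if x.1 then q else 1 - q) * (if x.2 then q else 1 - q)
  + (if x.1 == x.2 then c else - c).

Definition root_pair n (eta : leaf n -> bool * bool) : bool * bool :=
  (iter_maj3 (fun l => (eta l).1), iter_maj3 (fun l => (eta l).2)).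

Definition maj3_pair (z : (bool * bool) * (bool * bool) * (bool * bool)) :=
  (maj3 z.1.1.1 z.1.2.1 z.2.1, maj3 z.1.1.2 z.1.2.2 z.2.2).

Lemma root_pairS n (eta : leaf n.+1 -> bool * bool) :
  let sub k := root_pair (fun l : leaf n => eta (cons_tuple (inord k) l)) in
  root_pair eta = maj3_pair (sub 0%N, sub 1%N, sub 2%N).
Proof. by []. Qed.

(** Bijection between triples of labellings of depth n and labellings of depth n + 1. The head of a
    leaf is below 3, so the default of [nth] is never read. *)
Definition forest_join n
    (x : {ffun leaf n -> bool * bool} * {ffun leaf n -> bool * bool} *
         {ffun leaf n -> bool * bool}) : {ffun leaf n.+1 -> bool * bool} :=
  [ffun l : leaf n.+1 =>
     nth x.1.1 [:: x.1.1; x.1.2; x.2] (thead l : 'I_3) (behead_tuple l)].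

Definition forest_split n (eta : {ffun leaf n.+1 -> bool * bool}) :=
  let sub k := [ffun l : leaf n => eta (cons_tuple (inord k) l)] in
  (sub 0%N, sub 1%N, sub 2%N).

Lemma forest_join_cons n x (i : 'I_3) (l : leaf n) :
  forest_join x (cons_tuple i l) = nth x.1.1 [:: x.1.1; x.1.2; x.2] i l.
Proof.
rewrite ffunE theadE; congr (fun_of_fin _ _).
exact: val_inj.
Qed.

Lemma forest_joinK n : cancel (@forest_join n) (@forest_split n).
Proof.
move=> [[x y] z]; rewrite /forest_split; congr (_, _, _);
  by apply/ffunP => l; rewrite ffunE forest_join_cons inordK.
Qed.

Lemma forest_splitK n : cancel (@forest_split n) (@forest_join n).
Proof.
move=> eta; apply/ffunP => l.
rewrite (_ : l = cons_tuple (thead l) (behead_tuple l)); last first.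
  by rewrite [LHS]tuple_eta; exact: val_inj.
rewrite forest_join_cons; case: (thead l) => -[|[|[|//]]] hi /=; rewrite ffunE;
  congr (eta _); apply: val_inj => /=; congr (_ :: _);
  by apply: val_inj; rewrite /= inordK.
Qed.

Lemma prod_leafS n (F : leaf n.+1 -> R) :
  \prod_l F l = \prod_(i < 3) \prod_(l : leaf n) F (cons_tuple i l).
Proof.
rewrite pair_bigA /= (reindex (fun u : 'I_3 * leaf n => cons_tuple u.1 u.2)) //.
exists (fun l => (thead l, behead_tuple l)) => [[i l]|l] _ /=.
  by congr (_, _); exact: val_inj.
by rewrite [RHS]tuple_eta; apply: val_inj.
Qed.

Lemma sum_pair_distr (A B : finType) (P : pred A) (Q : pred B)
    (f : A -> R) (g : B -> R) :
  \sum_(x : A * B | P x.1 && Q x.2) f x.1 * g x.2 =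
  (\sum_(a | P a) f a) * (\sum_(b | Q b) g b).
Proof. by rewrite big_distrlr pair_big. Qed.

Definition root_weight (mu : bool * bool -> R) n c : R :=
  \sum_(eta : {ffun leaf n -> bool * bool} | root_pair eta == c)
    \prod_l mu (eta l).

(** The product over the leaves factors over the three subtrees; labellings are then grouped by the
    pairs at the roots of these subtrees. *)
Lemma root_weightS mu n c : root_weight mu n.+1 c =
  \sum_(z | maj3_pair z == c)
    root_weight mu n z.1.1 * root_weight mu n z.1.2 * root_weight mu n z.2.
Proof.
rewrite /root_weight (reindex (@forest_join n)); last first.
  by exists (@forest_split n) => x _; rewrite ?forest_joinK ?forest_splitK.
pose roots (x : {ffun leaf n -> bool * bool} * {ffun leaf n -> bool * bool} *
         {ffun leaf n -> bool * bool}) :=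
  (root_pair x.1.1, root_pair x.1.2, root_pair x.2).
have rootE x : root_pair (forest_join x) = maj3_pair (roots x).
  rewrite root_pairS; congr (maj3_pair (_, _, _)); congr root_pair;
  by apply/funext => l; rewrite forest_join_cons inordK.
rewrite (partition_big roots (fun z => maj3_pair z == c)); last first.
  by move=> x; rewrite rootE.
apply: eq_bigr => z /eqP zc.
rewrite -sum_pair_distr -(sum_pair_distr
  (fun x : {ffun leaf n -> bool * bool} * {ffun leaf n -> bool * bool} =>
    (root_pair x.1 == z.1.1) && (root_pair x.2 == z.1.2)) _
  (fun x => (\prod_l mu (x.1 l)) * \prod_l mu (x.2 l))).
apply: eq_big => [x|x _].
  rewrite rootE /roots; case: z zc => [[a b] d] /= zc.
  apply/andP/andP => [[_ /eqP[-> -> ->]]|]; first by rewrite !eqxx.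
  by case=> /andP[/eqP-> /eqP->] /eqP->; rewrite zc.
rewrite prod_leafS !big_ord_recl big_ord0 mulr1 mulrA.
by congr (_ * _ * _); apply: eq_bigr => l _; rewrite forest_join_cons.
Qed.

(** Majority keeps the family [pair_law], with the covariance of the expansion in centred bits.
    Verified by summing all 64 triples for each of the four values of [x]. *)
Lemma pair_law_maj3 q c x :
  \sum_(z | maj3_pair z == x)
    pair_law q c z.1.1 * pair_law q c z.1.2 * pair_law q c z.2 =
  pair_law (maj_mean q)
    (12 * (q * (1 - q)) ^+ 2 * c + 3 * (1 - 2 * q) ^+ 2 * c ^+ 2 + 4 * c ^+ 3) x.
Proof.
rewrite big_mkcond /= -(pair_bigA _ (fun a b => if maj3_pair (a, b) == x then
  pair_law q c a.1 * pair_law q c a.2 * pair_law q c b else 0)) /=.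
rewrite -(pair_bigA _ (fun a1 a2 => \sum_b if maj3_pair (a1, a2, b) == x then
  pair_law q c a1 * pair_law q c a2 * pair_law q c b else 0)) /=.
have bb (f : bool * bool -> R) : \sum_z f z =
    f (true, true) + f (true, false) + (f (false, true) + f (false, false)).
  rewrite (eq_bigr (fun z => f (z.1, z.2))); last by case.
  by rewrite -(pair_bigA _ (fun a b => f (a, b))) !big_bool.
rewrite !bb /pair_law /maj_mean.
by case: x => [[] []] /=; ring.
Qed.

Lemma root_weight_pair_law (p rho : R) n x : 0 <= p <= 1 / 2 ->
  root_weight (pair_law p (p * (1 - p) * rho)) n x =
  pair_law (root_mean p n)
    (root_mean p n * (1 - root_mean p n) * root_corr p rho n) x.
Proof.
move=> pb; elim: n x => [|n IH] x.
  rewrite /root_weight (reindex (fun b : bool * bool => [ffun=> b])); last first.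
    exists (fun eta : {ffun leaf 0 -> bool * bool} => eta [tuple]) => [b|eta] _.
      by rewrite ffunE.
    by apply/ffunP => l; rewrite ffunE (tuple0 l).
  rewrite (big_pred1 x) => [|b].
    rewrite (big_pred1 [tuple]) ?ffunE // => l.
    exact/esym/eqP/tuple0.
  by rewrite /root_pair /= !ffunE; case: b => a b.
rewrite root_weightS; under eq_bigr do rewrite !IH.
rewrite pair_law_maj3; congr pair_law.
exact/maj_cov_corr/root_mean_bound1.
Qed.

End PairLaw.

(** * Finite-valued random variables *)

Section FiniteVariables.
Context {R : realType} {d : measure_display} {T : measurableType d}.
Context (P : probability T R).

(** For finite [S] this is measurability with respect to all subsets of [S], without a measurable
    structure on [S]. *)
Definition measurable_fibers (S : Type) (Z : T -> S) :=
  forall s, measurable [set w | Z w = s].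

Lemma measurable_fin_event (S : finType) (Z : T -> S) (Q : S -> Prop) :
  measurable_fibers Z -> measurable [set w | Q (Z w)].
Proof.
move=> mZ; rewrite [X in measurable X](_ : _ =
  \bigcup_(s in [set s | Q s]) [set w | Z w = s]).
  by apply: fin_bigcup_measurable => //; exact: finite_finset.
by apply/seteqP; split => [w Qw|w [s Qs /= ->]] //; exists (Z w).
Qed.

Lemma measurable_fibers_ffun (I S : finType) (Z : I -> T -> S) :
  (forall i, measurable_fibers (Z i)) ->
  measurable_fibers (fun w => [ffun i => Z i w]).
Proof.
move=> mZ s; rewrite [X in measurable X](_ : _ =
  \bigcap_(i in [set: I]) [set w | Z i w = s i]).
  by apply: fin_bigcap_measurable => [|i _]; [exact: finite_finset|exact: mZ].
apply/seteqP; split => [w /= <- i _|w h]; first by rewrite /= ffunE.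
by apply/ffunP => i; rewrite ffunE; exact: h.
Qed.

Lemma measurable_finfun_event (I S : finType) (Z : I -> T -> S)
    (Q : (I -> S) -> Prop) :
  (forall i, measurable_fibers (Z i)) ->
  measurable [set w | Q (fun i => Z i w)].
Proof.
move=> /measurable_fibers_ffun mZ.
rewrite [X in measurable X](_ : _ =
  [set w | Q (fun i => [ffun i => Z i w] i)]).
  exact: (measurable_fin_event (fun z : {ffun I -> S} => Q z)).
apply/seteqP; split => w /=; congr Q; apply/funext => i; by rewrite ffunE.
Qed.

Lemma prob_fin_event (S : finType) (Z : T -> S) (Q : pred S) :
  measurable_fibers Z ->
  P [set w | Q (Z w)] = (\sum_(s | Q s) fine (P [set w | Z w = s]))%:E.
Proof.
move=> mZ; rewrite (_ : [set w | Q (Z w)] =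
  \bigcup_(s in [set` [seq s <- enum S | Q s]]) [set w | Z w = s]).
  rewrite measure_fin_bigcup //.
  - rewrite -fsbig_seq; last by rewrite filter_uniq // enum_uniq.
    rewrite big_filter big_enum_cond /= -sumEFin.
    by apply: eq_bigr => s _; rewrite fineK ?fin_num_measure.
  - by move=> s t _ _ [w [/= <- <-]].
apply/seteqP; split => [w Qw|w [s]]; last first.
  by rewrite /= mem_filter => /andP[Qs _] /= ->.
by exists (Z w) => //=; rewrite mem_filter mem_enum andbT.
Qed.

Lemma prob_union_bound (I : finType) (E : I -> T -> bool) :
  (forall i, measurable [set w | E i w]) ->
  (P [set w | exists i, E i w] <= \sum_i P [set w | E i w])%E.
Proof.
move=> mE; rewrite (_ : [set w | _] = [set w | has (E^~ w) (index_enum I)]).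
  elim: (index_enum I) => [|i r IH]; rewrite ?big_nil ?big_cons.
    by rewrite (_ : [set w | _] = set0) ?measure0 //; apply/seteqP; split.
  rewrite (_ : [set w | _] = [set w | E i w] `|` [set w | has (E^~ w) r]).
    apply: le_trans (measureU2 _ _ _) _ => //; last by rewrite leeD2l.
    elim: r {IH} => [|j r IH].
      by rewrite (_ : [set w | _] = set0) //; apply/seteqP; split.
    rewrite (_ : [set w | _] = [set w | E j w] `|` [set w | has (E^~ w) r]).
      exact: measurableU.
    by apply/seteqP; split => w /= /orP.
  by apply/seteqP; split => w /= /orP.
apply/seteqP; split => w /=.
  by move=> [i Ei]; apply/hasP; exists i => //; exact: mem_index_enum.
by move=> /hasP[i _ Ei]; exists i.
Qed.

(** Chebyshev's inequality: if no [A i] occurs, the centred count equals [- m * q]. The law of the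
    indicator vector is a finite weight [w], so every expectation is a finite sum. *)
Lemma second_moment (m : nat) (A : 'I_m -> T -> bool) (q kappa : R) :
  (forall i, measurable [set w | A i w]) -> 0 <= kappa ->
  (forall i, P [set w | A i w] = q%:E) ->
  (forall i j, i != j ->
    (P [set w | A i w && A j w] <= (q ^+ 2 + kappa)%:E)%E) ->
  (P [set w | forall i, ~~ A i w] * ((m%:R * q) ^+ 2)%:E <=
   (m%:R * (q * (1 - q)) + m%:R ^+ 2 * kappa)%:E)%E.
Proof.
move=> mA kappa0 mean cov.
pose Z w : {ffun 'I_m -> bool} := [ffun i => A i w].
have mZ : measurable_fibers Z.
  apply: measurable_fibers_ffun => i []; first exact: mA.
  rewrite (_ : [set w | _] = ~` [set w | A i w]); first exact: measurableC.
  by apply/seteqP; split => [w /= ->|w /negP/negbTE].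
pose w s := fine (P [set x | Z x = s]).
have w_ge0 s : 0 <= w s by rewrite fine_ge0.
have evE (Q : pred {ffun 'I_m -> bool}) (B : set T) :
    B = [set x | Q (Z x)] -> P B = (\sum_s w s * (Q s)%:R)%:E.
  move=> ->; rewrite prob_fin_event // big_mkcond; congr EFin.
  by apply: eq_bigr => s _; case: (Q s); rewrite ?mulr1 ?mulr0.
have total : \sum_s w s = 1.
  apply: EFin_inj; rewrite -(probability_setT P) (evE xpredT); last first.
    by apply/seteqP; split.
  by congr EFin; apply: eq_bigr => s _; rewrite mulr1.
have wmean i : \sum_s w s * (s i)%:R = q.
  apply: EFin_inj; rewrite -(mean i) (evE (fun s => s i)) //.
  by apply/seteqP; split => x /=; rewrite ffunE.
have wcov i j : i != j -> \sum_s w s * (s i && s j)%:R <= q ^+ 2 + kappa.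
  move=> /cov; rewrite (evE (fun s => s i && s j)) ?lee_fin //.
  by apply/seteqP; split => x /=; rewrite !ffunE.
rewrite (evE (fun s => [forall i, ~~ s i])); last first.
  apply/seteqP; split => x /=.
    by move=> h; apply/forallP => i; rewrite ffunE.
  by move=> /forallP h i; have := h i; rewrite ffunE.
rewrite -EFinM lee_fin.
apply: (@le_trans _ _ (\sum_s w s * (\sum_i ((s i)%:R - q)) ^+ 2)).
  rewrite mulr_suml; apply: ler_sum => s _; rewrite -mulrA ler_wpM2l //.
  case: forallP => [s0|_]; last by rewrite mul0r sqr_ge0.
  rewrite (eq_bigr (fun=> - q)) => [|i _].
    by rewrite mul1r sumr_const card_ord mulNrn sqrrN -[q *+ m]mulr_natl.
  by rewrite (negbTE (s0 i)) sub0r.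
have -> : \sum_s w s * (\sum_i ((s i)%:R - q)) ^+ 2 =
    \sum_i \sum_j (\sum_s w s * (s i && s j)%:R - q ^+ 2).
  under eq_bigr do rewrite expr2 big_distrlr mulr_sumr.
  rewrite exchange_big; apply: eq_bigr => i _.
  under eq_bigr do rewrite mulr_sumr.
  rewrite exchange_big; apply: eq_bigr => j _.
  rewrite (eq_bigr (fun s => w s * (s i && s j)%:R
      - q * (w s * (s i)%:R) - q * (w s * (s j)%:R) + w s * q ^+ 2)) => [|s _].
    rewrite big_split !sumrB -!mulr_sumr -mulr_suml !wmean total /=; ring.
  by case: (s i); case: (s j) => /=; ring.
(* Diagonal terms are variances [q * (1 - q)]; [kappa] is granted to the diagonal too, which costs
   nothing in sign and makes the sum uniform. *)
apply: (@le_trans _ _ (\sum_(i < m) \sum_(j < m)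
    (kappa + (if j == i then q * (1 - q) else 0)))).
  apply: ler_sum => i _; apply: ler_sum => j _; case: eqP => [->|/eqP ji].
    under eq_bigr do rewrite andbb.
    by rewrite wmean; lra.
  by rewrite addr0 lerBlDl; apply: wcov; rewrite eq_sym.
under eq_bigr do rewrite big_split /= sumr_const -big_mkcond /= big_pred1_eq.
rewrite sumr_const card_ord -[leLHS]mulr_natl -[kappa *+ _]mulr_natl; lra.
Qed.

End FiniteVariables.

(** * The two-state chain *)

Section TwoStateChain.
Context {R : realType}.

(** [lam t] is the (n+1)-st power of [lam h] at [h = t / (n+1)]. For small [h] the slope at 0 pins
    [lam h] between [expR (- (1 + 2 * eps) * h)] and [expR (- (1 - eps) * h)]; powers keep this, and
    [eps] is arbitrary. *)
Lemma expR_of_semigroup (lam : R -> R) :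
  (forall s t, 0 <= s -> 0 <= t -> lam (s + t) = lam s * lam t) ->
  h^-1 * (1 - lam h) @[h --> 0^'+] --> (1 : R) ->
  forall t, 0 < t -> lam t = expR (- t).
Proof.
move=> lamD dlam t t0.
have lam_ge0 s : 0 <= s -> 0 <= lam s.
  move=> s0; rewrite (splitr s) lamD; [|lra..].
  by rewrite -expr2 sqr_ge0.
have lamX s n : 0 <= s -> lam (n.+1%:R * s) = lam s ^+ n.+1.
  move=> s0; elim: n => [|n IH]; first by rewrite mul1r expr1.
  by rewrite -natr1 mulrDl mul1r lamD ?IH ?exprSr // mulr_ge0.
have transfer (U : R -> Prop) : (\forall h \near 0^'+, U h) ->
    exists n, U (t / n.+1%:R).
  move=> /nbhs_ballP[e /= e0 Ue].
  have [n te] : exists n : nat, t / e < n.+1%:R.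
    exists (Num.Def.archi_bound (t / e)).
    apply: lt_trans (archi_boundP _) _; first by rewrite divr_ge0 // ltW.
    by rewrite ltr_nat.
  exists n; apply: Ue; last by rewrite divr_gt0.
  rewrite /ball /= sub0r normrN gtr0_norm ?divr_gt0 //.
  by rewrite ltr_pdivrMr // mulrC -ltr_pdivrMr.
have split_t n : t = n.+1%:R * (t / n.+1%:R) by rewrite mulrCA mulfV ?mulr1.
have th0 n : 0 <= t / n.+1%:R by rewrite divr_ge0 // ltW.
have lower_upper (eps : R) : 0 < eps -> eps < 1 ->
    expR (- (1 + 2 * eps) * t) <= lam t <= expR (- (1 - eps) * t).
  move=> e0 e1.
  (* The second condition absorbs the quadratic term in [(1 - h * (1 + eps)) * (1 + (1 + 2 * eps) *
     h) >= 1]. *)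
  have : \forall h \near 0^'+, [/\ 0 < h, h * ((1 + eps) * (1 + 2 * eps)) < eps &
      `|1 - h^-1 * (1 - lam h)| < eps].
    near=> h; split.
    - by near: h; exact: nbhs_right_gt.
    - rewrite -ltr_pdivlMr; last by apply: mulr_gt0; lra.
      by near: h; apply: nbhs_right_lt; apply: divr_gt0 => //; apply: mulr_gt0; lra.
    - by near: h; move/cvgrPdist_lt: dlam; apply.
  move=> /transfer[n [h0 he]]; set h := t / n.+1%:R in h0 he *.
  set y := h^-1 * (1 - lam h) => /ltr_normlP[y1 y2].
  have lamE : lam h = 1 - h * y by rewrite /y mulrA mulfV ?gt_eqF //; ring.
  have hy1 : h * y <= h * (1 + eps) by rewrite ler_pM2l //; lra.
  have hy2 : h * (1 - eps) <= h * y by rewrite ler_pM2l //; lra.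
  have expE c : expR (c * t) = expR (c * h) ^+ n.+1.
    by rewrite -expRM_natl mulrCA -split_t.
  have -> : lam t = lam h ^+ n.+1 by rewrite -lamX ?ltW // -split_t.
  have lamh0 : 0 <= lam h by rewrite lam_ge0 // ltW.
  rewrite !expE; apply/andP; split; rewrite lerXn2r ?nnegrE ?expR_ge0 //; last first.
    by apply: le_trans (expR_ge1Dx _); lra.
  rewrite mulNr expRN -[leLHS]mul1r ler_pdivrMr ?expR_gt0 //.
  apply: le_trans (_ : lam h * (1 + (1 + 2 * eps) * h) <= _); last first.
    by rewrite ler_wpM2l // expR_ge1Dx.
  apply: le_trans (_ : (1 - h * (1 + eps)) * (1 + (1 + 2 * eps) * h) <= _).
    have : 0 <= h * (eps - h * ((1 + eps) * (1 + 2 * eps))) by rewrite mulr_ge0 //; lra.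
    lra.
  by rewrite ler_wpM2r //; [apply: addr_ge0 => //; apply: mulr_ge0; lra|lra].
have lam_gt0 : 0 < lam t.
  have /andP[+ _] := lower_upper (1 / 2) ltac:(lra) ltac:(lra).
  by apply: lt_le_trans; exact: expR_gt0.
rewrite -[lam t]lnK ?posrE //; congr expR.
have near_t (eps : R) : 0 < eps -> eps < 1 -> `|ln (lam t) + t| <= 2 * t * eps.
  move=> e0 e1; have := lower_upper eps e0 e1.
  rewrite -[lam t]lnK ?posrE // !ler_expR expRK => ?.
  by apply/ler_normlP; split; nra.
apply/eqP; rewrite -subr_eq0 opprK -normr_le0; apply/ler_addgt0Pr => e e0.
rewrite add0r.
pose eps := Num.min (1 / 2) (e / (2 * t)).
have eps0 : 0 < eps by rewrite lt_min; apply/andP; split; [lra|apply: divr_gt0; lra].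
apply: le_trans (near_t eps eps0 _) _; first by rewrite gt_min; apply/orP; left; lra.
rewrite mulrC -ler_pdivlMr; last lra.
by rewrite ge_min lexx orbT.
Unshelve. all: by end_near.
Qed.

End TwoStateChain.

(** * Law of a stationary two-state chain at two times *)

Section ChainLaw.
Context {R : realType} {d : measure_display} {T : measurableType d}.
Context (P : probability T R) (p : R) (Y : R -> T -> bool).
Hypothesis Y_markov : markov_chain P (flip_rate p) Y.
Hypothesis Y_stationary : stationary P Y.

Lemma chain_fibers t : 0 <= t -> measurable_fibers (Y t).
Proof.
move=> t0 b; have /(_ measurableT [set b]) := mc_measurable Y_markov t0.
by rewrite setTI; exact.
Qed.

Lemma chain_marginal t a : 0 <= t ->
  P [set w | Y t w = a] = P [set w | Y 0 w = a].
Proof.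
move=> t0; have := @Y_stationary 1 (fun=> 0) (fun=> a) t (fun=> lexx 0) t0.
rewrite add0r => h; transitivity (P [set w | forall i : 'I_1, Y t w = a]).
  by congr (P _); apply/seteqP; split => w /= => [?|/(_ ord0)].
by rewrite h; congr (P _); apply/seteqP; split => w /= => [/(_ ord0)|?].
Qed.

Lemma chain_total t s b : 0 <= t -> 0 <= s ->
  P [set w | Y t w = b] =
  (P [set w | Y s w = true /\ Y t w = b]
   + P [set w | Y s w = false /\ Y t w = b])%E.
Proof.
move=> t0 s0; rewrite -measureU.
- congr (P _); apply/seteqP; split => w /=; last by case=> -[].
  by case: (Y s w); [left|right].
- by apply: measurableI; exact: chain_fibers.
- by apply: measurableI; exact: chain_fibers.
- by apply/seteqP; split => w //= [[-> _] []].
Qed.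

Lemma chain_pair_law s t (x : bool * bool) : 0 <= s -> s < t ->
  P [set w | Y s w = x.1 /\ Y t w = x.2] =
  (pair_law p (p * (1 - p) * expR (- (t - s))) x)%:E.
Proof.
have [K semiK markovK] := mc_markov Y_markov.
pose pi b := fine (P [set w | Y 0 w = b]).
have piE u b : 0 <= u -> P [set w | Y u w = b] = (pi b)%:E.
  move=> u0; rewrite chain_marginal // fineK // fin_num_measure //.
  exact: chain_fibers.
have joint u v a b : 0 <= u -> u < v ->
    P [set w | Y u w = a /\ Y v w = b] = (pi a * K (v - u) a b)%:E.
  (* The Markov property takes an infinite increasing sequence of times; only its terms 0 and 1,
     which are [u] and [v], enter here. *)
  move=> u0 uv; pose tau i : R := u + i%:R * (v - u).
  have tau0 : tau 0%N = u by rewrite /tau mul0r addr0.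
  have tau1 : tau 1%N = v by rewrite /tau mul1r addrC subrK.
  have := markovK 0%N tau (fun i => if i is 0%N then a else b).
  rewrite tau0 tau1 => /(_ u0) hm.
  have {}hm := hm (fun i => ltac:(by rewrite ltrD2l ltr_pM2r ?subr_gt0 // ltr_nat)).
  rewrite EFinM -(piE u) //.
  transitivity (P [set w | forall i, (i <= 1)%N ->
      Y (tau i) w = if i is 0%N then a else b]).
    congr (P _); apply/seteqP; split => w /=.
      by move=> [Yu Yv] [|[|//]] _; rewrite ?tau0 ?tau1.
    by move=> h; have := h 0%N isT; have := h 1%N isT; rewrite tau0 tau1.
  rewrite hm; congr (P _ * _)%E; apply/seteqP; split => w /=.
    by move=> /(_ 0%N isT); rewrite tau0.
  by move=> Yu [|//] _; rewrite tau0.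
have pi1 : pi true + pi false = 1.
  apply: EFin_inj; rewrite EFinD -!(piE 0) // -(probability_setT P) -measureU.
  - congr (P _); apply/seteqP; split => w //= _.
    by case: (Y 0 w); [left|right].
  - exact: chain_fibers.
  - exact: chain_fibers.
  - by apply/seteqP; split => w //= [->].
have sumK h a : 0 < h -> K h a true + K h a false = 1.
  by move=> h0; rewrite -(trans_sum1 semiK a (ltW h0)) big_bool.
(* Equality of the laws at times 0 and [h] balances the two flows. Divided by [h] as [h] tends to 0
   this reads [pi true * (1 - p) = pi false * p], hence [pi true = p]. *)
have balance h : 0 < h -> pi true * K h true false = pi false * K h false true.
  move=> h0; have := chain_total true (ltW h0) (lexx 0).
  rewrite (piE h true (ltW h0)) !joint // !subr0 -EFinD => -[].
  by have := sumK h true h0; nra.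
have rate1 : h^-1 * K h true false @[h --> 0^'+] --> 1 - p.
  exact: (@trans_rate _ _ _ semiK true).
have rate0 : h^-1 * K h false true @[h --> 0^'+] --> p.
  exact: (@trans_rate _ _ _ semiK false).
have pi_true : pi true = p.
  have lim_balance : pi true * (h^-1 * K h true false)
      - pi false * (h^-1 * K h false true) @[h --> 0^'+] -->
      pi true * (1 - p) - pi false * p.
    by apply: cvgB; apply: cvgMr; [exact: rate1|exact: rate0].
  have lim0 : pi true * (h^-1 * K h true false)
      - pi false * (h^-1 * K h false true) @[h --> 0^'+] --> (0 : R).
    apply: (@cvg_trans _ ((fun=> 0 : R) @ 0^'+)); last exact: cvg_cst.
    apply: near_eq_cvg; near=> h.
    have h0 : 0 < h by near: h; exact: nbhs_right_gt.
    by rewrite !mulrA ![_ * h^-1]mulrC -!mulrA balance // subrr.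
  have : pi true * (1 - p) - pi false * p = 0.
    exact: cvg_unique lim_balance lim0.
  have -> : pi false = 1 - pi true by lra.
  lra.
have pi_false : pi false = 1 - p by lra.
(* The second eigenvalue of the stochastic matrix [K h]: it is multiplicative in [h], with slope
   [- (p + (1 - p)) = - 1] at 0. *)
pose lam h := 1 - K h true false - K h false true.
have lamE h : 0 < h -> lam h = expR (- h).
  apply: expR_of_semigroup => [u v u0 v0|].
    have diag w a : 0 <= w -> K w a a = 1 - K w a (~~ a).
      by move=> w0; rewrite -(trans_sum1 semiK a w0) big_bool; case: a => /=; ring.
    by rewrite /lam !(trans_semigroup semiK) // !big_bool /= !diag //=; ring.
  apply: (@cvg_trans _
      ((fun h => h^-1 * K h true false + h^-1 * K h false true) @ 0^'+)).
    by apply: near_eq_cvg; near=> r; rewrite /lam; ring.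
  have := cvgD rate1 rate0; rewrite subrK; exact.
move=> s0 st; rewrite joint //; congr EFin.
have h0 : 0 < t - s by lra.
have := balance _ h0; have := sumK _ true h0; have := sumK _ false h0.
rewrite -lamE // /lam pi_true pi_false /pair_law.
move: (K (t - s)) => k k0 k1 kb.
pose sg := k true false + k false true.
have kft : k false true = p * sg by rewrite /sg; lra.
have ktf : k true false = (1 - p) * sg by rewrite /sg; lra.
have ktt : k true true = 1 - (1 - p) * sg by lra.
have kff : k false false = 1 - p * sg by lra.
case: x => [[] []] /=; rewrite ?pi_true ?pi_false ?ktt ?kff ktf kft; ring.
Unshelve. all: by end_near.
Qed.

End ChainLaw.

(** * The root process *)

Section RootProcess.
Context {R : realType} {d : measure_display} {T : measurableType d}.
Context (P : probability T R) (p : R) (n : nat).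
Context (X : leaf n -> R -> T -> bool).
Hypothesis p_bound : 0 <= p <= 1 / 2.
Hypothesis X_flips : independent_stationary_flips P p X.

Definition root_state t w := iter_maj3 (fun l => X l t w).

Let q := root_mean p n.
Let v := nvar q.
Let rho s t := root_corr p (expR (- (t - s))) n.

Lemma leaf_fibers l t : 0 <= t -> measurable_fibers (X l t).
Proof. by apply: chain_fibers; exact: (flips_markov X_flips). Qed.

Lemma root_fibers t : 0 <= t -> measurable_fibers (root_state t).
Proof.
move=> t0 b; apply: (measurable_finfun_event (fun x => iter_maj3 x = b)) => l.
exact: leaf_fibers.
Qed.

Lemma leaf_event_sigma l t b : 0 <= t ->
  sigma_process (X l) [set w | X l t w = b].
Proof.
by move=> t0; apply: sub_sigma_algebra; exists t => //; exists [set b].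
Qed.

(** The pairs of states at [s] and [t] are independent over the leaves, so the leaf configuration
    has product law and [root_weight] computes the law at the root. *)
Lemma root_pair_prob s t x : 0 <= s -> s < t ->
  P [set w | (root_state s w, root_state t w) = x] =
  (pair_law q (q * (1 - q) * rho s t) x)%:E.
Proof.
move=> s0 st; have t0 : 0 <= t by lra.
pose Z w : {ffun leaf n -> bool * bool} := [ffun l => (X l s w, X l t w)].
have mpair l : measurable_fibers (fun w => (X l s w, X l t w)).
  move=> [a b]; rewrite [X in measurable X](_ : _ =
    [set w | X l s w = a] `&` [set w | X l t w = b]).
    by apply: measurableI; exact: leaf_fibers.
  by apply/seteqP; split => w /= [-> ->].
have mZ : measurable_fibers Z by exact: measurable_fibers_ffun.
have lawZ eta : P [set w | Z w = eta] =
    (\prod_l pair_law p (p * (1 - p) * expR (- (t - s))) (eta l))%:E.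
  pose A l := [set w | X l s w = (eta l).1] `&` [set w | X l t w = (eta l).2].
  have sA l : sigma_process (X l) (A l).
    have := @measurableI _ (g_sigma_algebraType
      [set A | exists2 t, 0 <= t & exists B : set bool, A = X l t @^-1` B]).
    by apply; exact: leaf_event_sigma.
  have := flips_independent X_flips sA [set: leaf n]%SET.
  rewrite (_ : \bigcap_(l in _) A l = [set w | Z w = eta]); last first.
    apply/seteqP; split => [w h|w Zw l _]; last by rewrite /A -Zw /= ffunE.
    apply/ffunP => l; rewrite ffunE.
    by have [/= -> ->] := h l (finset.in_setT l); case: (eta l).
  move=> ->; rewrite -prodEFin; apply: eq_big => l; first by rewrite finset.in_setT.
  move=> _; apply: chain_pair_law => //.
  - exact: (flips_markov X_flips).
  - exact: (flips_stationary X_flips).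
rewrite (_ : [set w | _] = [set w | root_pair (Z w) == x]).
  rewrite (prob_fin_event P (fun eta : {ffun leaf n -> bool * bool} =>
    root_pair eta == x) mZ); congr EFin.
  rewrite -root_weight_pair_law //; apply: eq_bigr => eta _.
  by rewrite lawZ.
have ZE w : root_pair (Z w) = (root_state s w, root_state t w).
  by congr (_, _); congr iter_maj3; apply/funext => l; rewrite ffunE.
by apply/seteqP; split => w /=; rewrite ZE => /eqP.
Qed.

Lemma root_pair_event s t (Q : pred (bool * bool)) : 0 <= s -> s < t ->
  P [set w | Q (root_state s w, root_state t w)] =
  (\sum_(x | Q x) pair_law q (q * (1 - q) * rho s t) x)%:E.
Proof.
move=> s0 st.
have mpair : measurable_fibers (fun w => (root_state s w, root_state t w)).
  move=> [a b]; rewrite [X in measurable X](_ : _ =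
    [set w | root_state s w = a] `&` [set w | root_state t w = b]).
    by apply: measurableI; apply: root_fibers; lra.
  by apply/seteqP; split => w /= [-> ->].
rewrite (prob_fin_event P Q mpair).
by congr EFin; apply: eq_bigr => x _; rewrite root_pair_prob.
Qed.

Let sum_pairs (F : bool * bool -> R) (Q : pred (bool * bool)) :
  \sum_(x | Q x) F x =
  (Q (true, true))%:R * F (true, true) + (Q (true, false))%:R * F (true, false)
  + (Q (false, true))%:R * F (false, true)
  + (Q (false, false))%:R * F (false, false).
Proof.
rewrite big_mkcond (eq_bigr (fun x => (Q (x.1, x.2))%:R * F (x.1, x.2))).
  by rewrite -(pair_bigA _ (fun a b => (Q (a, b))%:R * F (a, b))) !big_bool /= addrA.
by move=> [a b] _ /=; case: (Q _); rewrite ?mul1r ?mul0r.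
Qed.

Lemma root_state_prob t b : 0 <= t ->
  P [set w | root_state t w = b] = (if b then q else 1 - q)%:E.
Proof.
(* The law at one time is the first marginal of the pair law at [t] and [t + 1], where the
   covariance terms cancel. *)
move=> t0; have t1 : t < t + 1 by lra.
rewrite (_ : [set w | _] = [set w | (fun x => x.1 == b)
    (root_state t w, root_state (t + 1) w)]); last first.
  by apply/seteqP; split => w /= /eqP.
rewrite (root_pair_event (fun x => x.1 == b)) // sum_pairs /pair_law.
by congr EFin; case: b => /=; ring.
Qed.

Let expR_opp_bound (h : R) : 0 < h -> 0 <= expR (- h) <= 1.
Proof. by move=> h0; rewrite expR_ge0 -[leRHS]expR0 ler_expR; lra. Qed.

(** The states differ with probability [v * (1 - rho s t) / 2], and [1 - rho s t] is at most
    [2 ^+ n * (t - s)]. *)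
Lemma root_flip_prob s t : 0 <= s -> s < t ->
  (P [set w | root_state s w != root_state t w]
    <= (v * 2 ^+ n * (t - s))%:E)%E.
Proof.
move=> s0 st; rewrite (root_pair_event (fun x => x.1 != x.2)) // sum_pairs.
rewrite lee_fin /pair_law /=.
have rb : 0 <= expR (- (t - s)) <= 1 by apply: expR_opp_bound; lra.
have := root_corr_decorrelates p_bound n rb; rewrite -/(rho s t).
have h1 := expR_ge1Dx (- (t - s)).
have h2 : 2 ^+ n * (1 - expR (- (t - s))) <= 2 ^+ n * (t - s).
  by rewrite ler_wpM2l ?exprn_ge0 //; lra.
move=> h3; have v0 : 0 <= v by have := root_nvar_bound p_bound n; rewrite -/q -/v; lra.
have := ler_wpM2l v0 (le_trans h3 h2).
have -> : v * (1 - rho s t) = 4 * (q * (1 - q) * (1 - rho s t)).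
  by rewrite /v /nvar; ring.
have : 0 <= v * (2 ^+ n * (t - s)).
  by apply: mulr_ge0 => //; apply: mulr_ge0; [exact: exprn_ge0|lra].
lra.
Qed.

(* [expR h - 1 >= h] makes [1 / h] a bound for the initial ratio
   [rho / (1 - rho)]. *)
Lemma root_corr_upper h s t : 0 < h -> h <= t - s ->
  rho s t <= (3 / 4) ^+ n / h.
Proof.
move=> h0 hst; apply: root_corr_contracts => //; first by apply: expR_opp_bound; lra.
  by rewrite invr_ge0 ltW.
rewrite mulrC ler_pdivlMr //.
have e0 := expR_gt0 (- (t - s)).
have := ler_wpM2l (ltW e0) (expR_ge1Dx (t - s)).
rewrite -expRD addNr expR0 => ?; nra.
Qed.

Lemma root_joint_prob h s t b : 0 < h -> 0 <= s -> 0 <= t -> h <= `|t - s| ->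
  (P [set w | (root_state s w == b) && (root_state t w == b)] <=
   ((if b then q else 1 - q) ^+ 2 + q * (1 - q) * ((3 / 4) ^+ n / h))%:E)%E.
Proof.
move=> h0.
wlog st : s t / s < t => [wl|] s0 t0 hst.
  have [st|ts|st] := ltgtP s t; first exact: wl.
    under eq_set do rewrite andbC.
    by apply: wl => //; rewrite distrC.
  by move: hst; rewrite st subrr normr0 leNgt h0.
rewrite (root_pair_event (fun x => (x.1 == b) && (x.2 == b))) // sum_pairs lee_fin.
rewrite gtr0_norm ?subr_gt0 // in hst.
have := root_corr_upper h0 hst.
have : 0 <= q * (1 - q).
  by have := root_mean_bound p_bound n; rewrite -/q => ?; apply: mulr_ge0; lra.
move=> /ler_wpM2l/[apply]; rewrite /pair_law.
by case: b => /=; lra.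
Qed.

End RootProcess.

(** * Changes of a cadlag path *)

Section Paths.
Context {R : realType}.
Implicit Types (g : R -> bool).

Lemma cadlag_fin (I : finType) (f : (I -> bool) -> bool) (x : I -> R -> bool) :
  (forall i, cadlag (x i)) -> cadlag (fun t => f (fun i => x i t)).
Proof.
move=> hx; split => t t0.
  have : \forall s \near t^'+, forall i, x i s = x i t.
    by apply: filter_forall => i; exact: (hx i).1.
  by apply: filterS => s hs; congr f; apply/funext.
have left_lim i : exists b, \forall s \near t^'-, x i s = b := (hx i).2 t t0.
pose b i := xget false [set b | \forall s \near t^'-, x i s = b].
exists (f b).
have : \forall s \near t^'-, forall i, x i s = b i.
  by apply: filter_forall => i; exact: (xgetPex false (left_lim i)).
by apply: filterS => s hs; congr f; apply/funext.
Qed.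

(** Take the supremum [u] of the times up to which [g] keeps the value [g a]. If [g u] were still
    [g a], right-continuity would carry this value beyond [u], so [g] jumps at [u]. *)
Lemma change_between g (a b : R) : cadlag g -> 0 <= a -> a < b -> g a != g b ->
  exists2 t, a < t <= b & \forall s \near t^'-, g s != g t.
Proof.
move=> [gr _] a0 ab gab.
pose S := [set s | a <= s <= b /\ forall r, a <= r <= s -> g r = g a].
have Sa : S a.
  split; first by rewrite lexx ltW.
  by move=> r ra; congr g; apply/eqP; rewrite eq_le andbC.
have Sb : has_sup S by split; [exists a|exists b => s [/andP[]]].
pose u := sup S.
have au : a <= u by apply: sup_upper_bound.
have ub : u <= b by apply: sup_le_ub; [exists a|move=> s [/andP[]]].
have before r : a <= r -> r < u -> g r = g a.
  move=> ar ru; have [|s [sab hs] rs] := @sup_adherent _ S (u - r) _ Sb.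
    by rewrite subr_gt0.
  apply: hs; rewrite ar /=; apply: ltW; apply: le_lt_trans rs.
  by rewrite -/u opprB addrC subrK.
have gu : g u != g a.
  apply/eqP => gua.
  have ltub : u < b.
    rewrite lt_neqAle ub andbT; apply/eqP => eub.
    by move: gab; rewrite -eub gua eqxx.
  have [e /= e0 he] := (nbhs_ballP _ _).1 (gr u (le_trans a0 au)).
  pose s := Num.min b (u + e / 2).
  have us : u < s by rewrite lt_min ltub /= ltrDl; apply: divr_gt0.
  have : s <= u.
    apply: sup_upper_bound => //; split.
      by rewrite (ltW (le_lt_trans au us)) /= ge_min lexx.
    move=> r /andP[ar rs]; have [ru|ur|->] := ltgtP r u; last exact: gua.
      exact: before.
    rewrite -gua; apply: he => //; rewrite /ball /=.
    have : r <= u + e / 2 by apply: le_trans rs _; rewrite ge_min lexx orbT.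
    by move=> h; rewrite ltr_distl; apply/andP; split; lra.
  by rewrite leNgt us.
have ltau : a < u.
  by rewrite lt_neqAle au andbT; apply/eqP => e; rewrite e eqxx in gu.
exists u; first by rewrite ltau.
near=> s; rewrite (before s) 1?eq_sym //; near: s.
by apply: filterS (nbhs_left_gt ltau) => s /ltW.
Unshelve. all: by end_near.
Qed.

Lemma counting_ge (A : set R) (m : nat) (h : 'I_m -> R) :
  injective h -> (forall i, A (h i)) -> (m%:R%:E <= counting A :> \bar R)%E.
Proof.
move=> h_inj hA; rewrite /counting; case: asboolP => [finA|_]; last exact: leey.
rewrite lee_fin ler_nat.
have -> : m = size [seq h i | i <- enum 'I_m] by rewrite size_map size_enum_ord.
apply: uniq_leq_size; first by rewrite map_inj_uniq ?enum_uniq.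
by move=> x /mapP[i _ ->]; rewrite in_fset_set // inE; exact: hA.
Qed.

(** Each interval contains a change, and being open on the left and closed on the right, intervals
    with a common endpoint still give distinct changes. *)
Lemma counting_change_times_ge g (m : nat) (u v : 'I_m -> R) : cadlag g ->
  (forall i, [/\ 0 <= u i, u i < v i, v i <= 1 & g (u i) != g (v i)]) ->
  (forall i j, i != j -> v i <= u j \/ v j <= u i) ->
  (m%:R%:E <= counting (change_times g) :> \bar R)%E.
Proof.
move=> cg uv disj.
have jump i : exists t, u i < t <= v i /\ \forall s \near t^'-, g s != g t.
  have [u0 uvi v1 guv] := uv i.
  by have [t ht gt] := change_between cg u0 uvi guv; exists t.
have [h hh] := choice jump.
apply: (@counting_ge _ _ h) => [i j hij|i]; last first.
  have [[/andP[ut tv] gt] [u0 _ v1 _]] := (hh i, uv i).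
  by split => //; apply/andP; split; [exact: le_lt_trans ut|exact: le_trans v1].
apply/eqP/negPn/negP => /disj.
have /andP[ui vi] := (hh i).1; have /andP[uj vj] := (hh j).1.
by rewrite -hij in uj vj; case=> ?; lra.
Qed.

(** Changes visible on the grid of mesh [1 / (k+1)]: they depend on finitely many times, so their
    events are measurable and admit a union bound. *)
Definition grid_changes g (k : nat) : {set 'I_k.+1} :=
  [set i : 'I_k.+1 | g (i%:R / k.+1%:R) != g (i.+1%:R / k.+1%:R)]%SET.

Lemma grid_changes_le g k m : cadlag g -> (m <= #|grid_changes g k|)%N ->
  (m%:R%:E <= counting (change_times g) :> \bar R)%E.
Proof.
move=> cg mk; pose e (i : 'I_m) := enum_val (widen_ord mk i).
have e_inj : injective e.
  by move=> i j /enum_val_inj/(congr1 val)/= ?; exact: val_inj.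
apply: (@counting_change_times_ge _ _ (fun i => (e i)%:R / k.+1%:R)
  (fun i => (e i).+1%:R / k.+1%:R) cg) => [i|i j ij].
  have := enum_valP (widen_ord mk i); rewrite -/(e i) finset.inE => gi; split => //.
  - by rewrite ltr_pM2r ?invr_gt0 // ltr_nat.
  - by rewrite ler_pdivrMr // mul1r ler_nat.
have le_e (a b : 'I_k.+1) : (a < b)%N ->
    a.+1%:R / k.+1%:R <= b%:R / k.+1%:R :> R.
  by move=> ab; rewrite ler_pM2r ?invr_gt0 // ler_nat.
have [eij|eji|/val_inj/e_inj] := ltngtP (e i) (e j); last by move/eqP; rewrite (negbTE ij).
- by left; exact: le_e.
- by right; exact: le_e.
Qed.

Lemma grid_cell (k : nat) (t : R) : 0 < t <= 1 ->
  exists i : 'I_k.+1, i%:R / k.+1%:R < t <= i.+1%:R / k.+1%:R.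
Proof.
move=> /andP[t0 t1].
have ex : exists i : nat, t <= i%:R / k.+1%:R.
  by exists k.+1; rewrite divff // pnatr_eq0.
case: (ex_minnP ex) => -[|i] ti imin; first by rewrite mul0r leNgt t0 in ti.
have ik : (i < k.+1)%N by apply: imin; rewrite divff // pnatr_eq0.
exists (Ordinal ik); rewrite ti andbT /= ltNge; apply/negP => /imin.
by rewrite ltnn.
Qed.

Lemma near_grid_small (e : R) : 0 < e -> \forall k \near \oo, k.+1%:R^-1 < e.
Proof.
move=> e0; apply: filterS (nbhs_infty_gtr e^-1) => k ek.
rewrite invf_plt ?posrE //; apply: lt_trans ek _.
by rewrite ltr_nat.
Qed.

(** Once the mesh is small, the left end of the cell of [t] carries the left limit, which differs
    from [g t]; the right end is [t] or close to its right, and carries [g t]. *)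
Lemma change_time_seen g t : cadlag g -> change_times g t ->
  \forall k \near \oo, forall i : 'I_k.+1,
    i%:R / k.+1%:R < t <= i.+1%:R / k.+1%:R -> i \in grid_changes g k.
Proof.
move=> [gr _] [/andP[t0 _] gl].
have [e1 /= e10 he1] := (nbhs_ballP _ _).1 (gr t (ltW t0)).
have [e2 /= e20 he2] := (nbhs_ballP _ _).1 gl.
have e0 : 0 < Num.min e1 e2 by rewrite lt_min e10 e20.
apply: filterS (near_grid_small e0) => k; rewrite lt_min => /andP[k1 k2] i.
move=> /andP[it ti]; rewrite finset.inE.
have step : i.+1%:R / k.+1%:R = i%:R / k.+1%:R + k.+1%:R^-1 :> R.
  by rewrite -natr1 mulrDl mul1r.
have -> : g (i.+1%:R / k.+1%:R) = g t.
  have [->//|tneq] := eqVneq (i.+1%:R / k.+1%:R) t.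
  apply: he1; last by rewrite lt_neqAle eq_sym tneq.
  rewrite /ball /= ltr_distl step; rewrite step in ti.
  move: {step tneq} (i%:R / k.+1%:R) it ti => a it ti.
  by move: k.+1%:R^-1 k1 ti => b k1 ti; apply/andP; split; lra.
apply: he2 => //; rewrite /ball /= ltr_distl.
rewrite step in ti; move: {step} (i%:R / k.+1%:R) it ti => a it ti.
by move: k.+1%:R^-1 k2 ti => b k2 ti; apply/andP; split; lra.
Qed.

(** Choose finitely many change times, at least [m]. A fine enough grid sees each of them, and a
    mesh below their mutual distances puts them in different cells. *)
Lemma near_grid_changes_ge g m : cadlag g ->
  (m%:R%:E <= counting (change_times g) :> \bar R)%E ->
  \forall k \near \oo, (m <= #|grid_changes g k|)%N.
Proof.
move=> cg mC.
have [B [uB BA mB]] : exists B : seq R,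
    [/\ uniq B, forall t, t \in B -> change_times g t & (m <= size B)%N].
  move: mC; rewrite /counting; case: asboolP => [finA|infA] mC.
    exists (finmap.enum_fset (fset_set (change_times g))); split.
    - exact: finmap.fset_uniq.
    - by move=> t; rewrite in_fset_set // inE.
    - by move: mC; rewrite lee_fin ler_nat.
  have [B BA mB] := infinite_set_fset m infA.
  by exists (finmap.enum_fset B); split => //; exact: finmap.fset_uniq.
pose t (i : 'I_(size B)) := B`_i.
have tB i : change_times g (t i) by apply/BA/mem_nth.
have seen : \forall k \near \oo, forall i, forall j : 'I_k.+1,
    j%:R / k.+1%:R < t i <= j.+1%:R / k.+1%:R -> j \in grid_changes g k.
  by apply: filter_forall => i; exact: change_time_seen.
have apart : \forall k \near \oo, forall ij : 'I_(size B) * 'I_(size B),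
    ij.1 != ij.2 -> k.+1%:R^-1 < `|t ij.1 - t ij.2|.
  apply: filter_forall => -[i j] /=.
  have [->|ij] := eqVneq i j; first by near=> k.
  have tij : 0 < `|t i - t j|.
    by rewrite normr_gt0 subr_eq0 /t nth_uniq //; apply: contra ij => /eqP/val_inj->.
  by apply: filterS (near_grid_small tij).
near=> k; apply: leq_trans mB _.
have cell i : exists j : 'I_k.+1, j%:R / k.+1%:R < t i <= j.+1%:R / k.+1%:R.
  exact/grid_cell/(tB i).1.
have [c hc] := choice cell.
have c_inj : injective c.
  move=> i j cij; apply/eqP/negPn/negP => ij.
  have : k.+1%:R^-1 < `|t i - t j|.
    have : forall ij : 'I_(size B) * 'I_(size B),
      ij.1 != ij.2 -> k.+1%:R^-1 < `|t ij.1 - t ij.2| by near: k.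
    by move=> /(_ (i, j)); exact.
  have := hc i; have := hc j; rewrite -cij -[(c i).+1%:R]natr1 mulrDl mul1r.
  move: ((c i)%:R / k.+1%:R) => a; move: k.+1%:R^-1 => b hj hi.
  apply/negP; rewrite -leNgt.
  by apply/ler_normlP; split; lra.
rewrite -(card_ord (size B)) -(card_codom c_inj).
apply/subset_leq_card/fintype.subsetP => _ /codomP[i ->].
suff : forall i, forall j : 'I_k.+1,
    j%:R / k.+1%:R < t i <= j.+1%:R / k.+1%:R -> j \in grid_changes g k.
  by apply; exact: hc.
by near: k.
Unshelve. all: by end_near.
Qed.

End Paths.

(** * Number of changes at the root *)

Section Changes.
Context {R : realType} {d : measure_display} {T : measurableType d}.
Context (P : probability T R) (p : R) (n : nat).
Context (X : leaf n -> R -> T -> bool).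
Hypothesis p_bound : 0 <= p <= 1 / 2.
Hypothesis X_flips : independent_stationary_flips P p X.

Let C w : \bar R := num_changes (@iter_maj3 n) X w.
Let g t w := root_state X t w.
Let q := root_mean p n.
Let v := nvar q.

Lemma root_cadlag w : cadlag (g^~ w).
Proof.
by apply: cadlag_fin => l; exact: (mc_cadlag (flips_markov X_flips l)).
Qed.

Lemma num_changes_geP m : [set w | (m%:R%:E <= C w)%E] =
  \bigcup_k [set w | (m <= #|grid_changes (g^~ w) k|)%N].
Proof.
apply/seteqP; split => [w h|w [k _ /= h]].
  have [k _ hk] := near_grid_changes_ge (root_cadlag w) h.
  by exists k => //; exact: (hk k (leqnn k)).
exact: grid_changes_le (root_cadlag w) h.
Qed.

Lemma measurable_grid_changes k m :
  measurable [set w | (m <= #|grid_changes (g^~ w) k|)%N].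
Proof.
(* [widen_ord] and [lift ord0] send cell [i] to its endpoints [i] and [i + 1] among the [k + 2] grid
   points. *)
pose Q (z : 'I_k.+2 -> bool) :=
  (m <= #|[set i : 'I_k.+1 | z (widen_ord (leqnSn _) i) != z (lift ord0 i)]%SET|)%N.
apply: (@measurable_finfun_event _ _ _ _ (fun (i : 'I_k.+2) w => g (i%:R / k.+1%:R) w) Q) => i.
by apply: (root_fibers X_flips); rewrite divr_ge0.
Qed.

Lemma measurable_num_changes_ge m : measurable [set w | (m%:R%:E <= C w)%E].
Proof.
rewrite num_changes_geP; apply: bigcup_measurable => k _.
exact: measurable_grid_changes.
Qed.

(** There are [k + 1] cells of length [1 / (k+1)] and the flip bound is linear in the length, so the
    sum does not depend on [k]. *)
Lemma grid_change_prob k :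
  (P [set w | (1 <= #|grid_changes (g^~ w) k|)%N] <= (v * 2 ^+ n)%:E)%E.
Proof.
pose E (i : 'I_k.+1) w := g (i%:R / k.+1%:R) w != g (i.+1%:R / k.+1%:R) w.
have N0 : 0 < k.+1%:R^-1 :> R by rewrite invr_gt0.
have u0 (i : nat) : 0 <= i%:R / k.+1%:R :> R by rewrite divr_ge0.
have step (i : nat) : i.+1%:R / k.+1%:R = i%:R / k.+1%:R + k.+1%:R^-1 :> R.
  by rewrite -natr1 mulrDl mul1r.
rewrite (_ : [set w | _] = [set w | exists i, E i w]); last first.
  apply/seteqP; split => w /=.
    by move=> /card_gt0P[i]; rewrite finset.inE => Ei; exists i.
  by move=> [i Ei]; apply/card_gt0P; exists i; rewrite finset.inE.
apply: le_trans (prob_union_bound P _) _ => [i|].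
  have mg t : 0 <= t -> measurable_fibers (g t) by exact: root_fibers X_flips _.
  pose Q (z : bool -> bool) : Prop := z true != z false.
  apply: (@measurable_finfun_event _ _ _ _
    (fun b : bool => g ((if b then i : nat else i.+1)%:R / k.+1%:R)) Q) => b.
  exact: mg.
apply: le_trans (_ : (\sum_(i < k.+1) (v * 2 ^+ n * k.+1%:R^-1)%:E <= _)%E).
  apply: lee_sum => i _.
  have st : i%:R / k.+1%:R < i.+1%:R / k.+1%:R :> R by rewrite step ltrDl.
  apply: le_trans (root_flip_prob p_bound X_flips (u0 i) st) _.
  by rewrite step addrC addKr.
rewrite sumEFin lee_fin sumr_const card_ord -[leLHS]mulr_natr mulfVK //.
Qed.

Lemma some_change_prob : (P [set w | (1%:R%:E <= C w)%E] <= (v * 2 ^+ n)%:E)%E.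
Proof.
(* The grids are not nested. Asking for a visible change on every grid from index [j] on yields
   events increasing to the event of a change, and continuity from below applies. *)
pose F j := \bigcap_k [set w | (1 <= #|grid_changes (g^~ w) (j + k)|)%N].
have FE : [set w | (1%:R%:E <= C w)%E] = \bigcup_j F j.
  apply/seteqP; split => [w h|w [j _ /(_ 0%N I) /= h]]; last first.
    exact: grid_changes_le (root_cadlag w) h.
  have [j _ hj] := near_grid_changes_ge (root_cadlag w) h.
  by exists j => // k _ /=; apply: hj => /=; exact: leq_addr.
have mF j : measurable (F j).
  by apply: bigcapT_measurable => k; exact: measurable_grid_changes.
have F_mono : {homo F : i j / (i <= j)%N >-> (i <= j)%O}.
  move=> i j ij; apply/subsetPset => w Fi k _ /=.
  by have := Fi (j - i + k)%N I; rewrite /= addnA subnKC.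
have := nondecreasing_cvg_mu (mu := P) mF (bigcup_measurable (fun k _ => mF k)) F_mono.
rewrite FE => /cvge_to_le; apply.
apply: nearW => j /=; apply: le_trans (grid_change_prob j).
apply: le_measure; rewrite ?inE //; first exact: measurable_grid_changes.
by move=> w /(_ 0%N I); rewrite addn0.
Qed.

Lemma no_changeE : [set w | C w = 0%E] = ~` [set w | (1%:R%:E <= C w)%E].
Proof.
apply/seteqP; split => w /=; first by move=> ->; rewrite lee_fin ler10.
rewrite /C /num_changes /counting; case: asboolP => [_|_]; last by rewrite leey.
by rewrite lee_fin ler_nat => /negP; rewrite -eqn0Ngt => /eqP->.
Qed.

Lemma no_change_prob :
  ((1 - v * 2 ^+ n)%:E <= P [set w | C w = 0%E] <= 1)%E.
Proof.
have mC := measurable_num_changes_ge 1.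
rewrite no_changeE probability_le1 ?andbT; last exact: measurableC.
by rewrite probability_setC // EFinB leeB // some_change_prob.
Qed.

(** * Blocks of consecutive, equally spaced times *)

Section Blocks.
Context (K m : nat).
Hypotheses (K0 : (0 < K)%N) (m0 : (0 < m)%N).

Let time (i : 'I_K) (k : 'I_m) : R := (i * m + k)%:R / (K * m)%:R.
Let missing (i : 'I_K) (b : bool) (w : T) := [forall k, g (time i k) w != b].

Let Km0 : 0 < (K * m)%:R :> R.
Proof. by rewrite ltr0n muln_gt0 K0. Qed.

Let time_ge0 i k : 0 <= time i k.
Proof. by rewrite divr_ge0. Qed.

Let time_fibers i k : measurable_fibers (g (time i k)).
Proof. by apply: (root_fibers X_flips); exact: time_ge0. Qed.

Lemma measurable_missing i b : measurable [set w | missing i b w].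
Proof.
pose Q (z : 'I_m -> bool) : Prop := [forall k, z k != b].
by apply: (@measurable_finfun_event _ _ _ _ (fun k => g (time i k)) Q).
Qed.

(* Second moment over the [m] times of a block: consecutive times are
   [1 / (K m)] apart, which bounds their correlation. *)
Lemma missing_prob i b : 0 < v ->
  (P [set w | missing i b w] <=
   (4 / v * (m%:R^-1 + (3 / 4) ^+ n * (K * m)%:R))%:E)%E.
Proof.
move=> v0; pose qb := if b then q else 1 - q; pose s2 := q * (1 - q).
have vE : v = 4 * s2 by rewrite /v /nvar /s2; ring.
have s20 : 0 < s2 by lra.
have qbound := root_mean_bound p_bound n; rewrite -/q in qbound.
(* This turns the Chebyshev bound [s2 * y / qb ^+ 2], with [y] as below, into [y / s2 = 4 / v * y],
   the same for both values of [b]. *)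
have qb_s2 : s2 <= qb by rewrite /qb /s2; case: (b); nra.
pose kappa := s2 * ((3 / 4) ^+ n / (K * m)%:R^-1).
have m0R : 0 < m%:R :> R by rewrite ltr0n.
have := @second_moment _ _ _ P m (fun k w => g (time i k) w == b) qb kappa.
have mE k : measurable [set w | g (time i k) w == b].
  rewrite (_ : [set w | _] = [set w | g (time i k) w = b]); first exact: time_fibers.
  by apply/seteqP; split => w /= /eqP.
have kappa0 : 0 <= kappa.
  by rewrite mulr_ge0 ?(ltW s20) // divr_ge0 ?exprn_ge0 ?invr_ge0 //; lra.
have mean k : P [set w | g (time i k) w == b] = qb%:E.
  rewrite -(root_state_prob p_bound X_flips b (time_ge0 i k)).
  by congr (P _); apply/seteqP; split => w /= /eqP.
have cov k l : k != l ->
    (P [set w | (g (time i k) w == b) && (g (time i l) w == b)]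
      <= (qb ^+ 2 + kappa)%:E)%E.
  move=> kl; apply: (root_joint_prob p_bound X_flips) => //.
    by rewrite invr_gt0.
  rewrite -mulrBl normrM (gtr0_norm (_ : 0 < (K * m)%:R^-1)) ?invr_gt0 //.
  rewrite ler_peMl ?invr_ge0 // !natrD opprD addrACA subrr add0r.
  have gap (a c : 'I_m) : (a < c)%N -> 1 <= `|c%:R - a%:R : R|.
    by move=> ac; apply: le_trans (ler_norm _); rewrite lerBrDl natr1 ler_nat.
  by move: kl; rewrite neq_ltn => /orP[]; [|rewrite distrC]; exact: gap.
move=> /(_ mE kappa0 mean cov).
rewrite (_ : [set w | forall k, _] = [set w | missing i b w]); last first.
  by apply/seteqP; split => w /= => [h|/forallP h]; [apply/forallP|] => k; exact: h.
have fP : P [set w | missing i b w] \is a fin_num.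
  exact: fin_num_measure (measurable_missing i b).
rewrite -[P _](fineK fP) -EFinM !lee_fin.
move: (fine _) => x hx.
have qqb : qb * (1 - qb) = s2 by rewrite /qb /s2; case: (b); ring.
rewrite qqb in hx.
have pos : 0 < m%:R ^+ 2 * qb ^+ 2 by rewrite mulr_gt0 ?exprn_gt0 //; lra.
have {}hx : x <= (m%:R * s2 + m%:R ^+ 2 * kappa) / (m%:R ^+ 2 * qb ^+ 2).
  by rewrite ler_pdivlMr // -exprMn.
apply: le_trans hx _; rewrite ler_pdivrMr //.
pose y : R := m%:R^-1 + (3 / 4) ^+ n * (K * m)%:R.
have -> : m%:R * s2 + m%:R ^+ 2 * kappa = m%:R ^+ 2 * s2 * y.
  rewrite /kappa /y invrK; field; exact: lt0r_neq0.
have y0 : 0 <= y.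
  by apply: addr_ge0; [rewrite invr_ge0 ltW|rewrite mulr_ge0 ?exprn_ge0 //; lra].
rewrite -/y (_ : 4 / v = s2^-1); last first.
  by rewrite vE; field; rewrite lt0r_neq0.
rewrite -subr_ge0.
have -> : s2^-1 * y * (m%:R ^+ 2 * qb ^+ 2) - m%:R ^+ 2 * s2 * y =
    m%:R ^+ 2 * y * s2^-1 * (qb ^+ 2 - s2 ^+ 2).
  by field; rewrite lt0r_neq0.
apply: mulr_ge0; last by rewrite subr_ge0 lerXn2r // nnegrE; lra.
by rewrite mulr_ge0 ?invr_ge0 ?(ltW s20) // mulr_ge0 // sqr_ge0.
Qed.

(** A block showing both values contains two times with different states, hence a change, and the
    blocks do not overlap. *)
Lemma num_changes_ge_blocks w : (forall i b, ~~ missing i b w) ->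
  (K%:R%:E <= C w)%E.
Proof.
move=> full.
have hit i b : exists k, g (time i k) w = b.
  have /forallPn[k] := full i b; rewrite negbK => /eqP gb.
  by exists k.
have two i : exists k : 'I_m * 'I_m,
    (k.1 < k.2)%N /\ g (time i k.1) w != g (time i k.2) w.
  have [[k gk] [l gl]] := (hit i true, hit i false).
  have [kl|lk|kl] := ltngtP k l.
  - by exists (k, l); rewrite gk gl.
  - by exists (l, k); rewrite gk gl.
  - by move: gk; rewrite (val_inj kl) gl.
have [k hk] := choice two.
apply: (counting_change_times_ge (u := fun i => time i (k i).1)
  (v := fun i => time i (k i).2) (root_cadlag w)) => [i|i j ij].
  have [kk gk] := hk i; split => //.
  - by rewrite ltr_pM2r ?invr_gt0 // ltr_nat ltn_add2l.
  - rewrite ler_pdivrMr // mul1r ler_nat.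
    apply: leq_trans (_ : i.+1 * m <= _)%N; last by rewrite leq_mul2r ltn_ord orbT.
    by rewrite mulSn addnC leq_add2r ltnW.
have before (a b : 'I_K) (x y : 'I_m) : (a < b)%N -> time a x <= time b y.
  move=> ab; rewrite ler_pM2r ?invr_gt0 // ler_nat.
  apply: leq_trans (_ : a.+1 * m <= _)%N.
    by rewrite mulSn addnC leq_add2r ltnW.
  by apply: leq_trans (leq_addr _ _); rewrite leq_mul2r ab orbT.
by move: ij; rewrite neq_ltn => /orP[ij|ij]; [left|right]; exact: before.
Qed.

(** The factor [2 * K] counts the pairs of a block and a value that it may miss. *)
Lemma many_changes_prob : 0 < v ->
  ((1 - 2 * K%:R * (4 / v * (m%:R^-1 + (3 / 4) ^+ n * (K * m)%:R)))%:E
    <= P [set w | (K%:R%:E <= C w)%E])%E.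
Proof.
move=> v0; set y := 4 / v * _.
pose E (ib : 'I_K * bool) w := missing ib.1 ib.2 w.
pose B := [set w | exists ib, E ib w].
have mE ib : measurable [set w | E ib w] by exact: measurable_missing.
have PB : (P B <= (2 * K%:R * y)%:E)%E.
  apply: le_trans (prob_union_bound P mE) _.
  apply: le_trans (_ : (\sum_(ib : 'I_K * bool) y%:E <= _)%E).
    by apply: lee_sum => ib _; exact: missing_prob.
  rewrite sumEFin sumr_const card_prod card_ord card_bool lee_fin.
  by rewrite -[leLHS]mulr_natl natrM (mulrC K%:R).
have mB : measurable B.
  rewrite (_ : B = \bigcup_(ib in [set: 'I_K * bool]) [set w | E ib w]).
    by apply: fin_bigcup_measurable => //; exact: finite_finset.
  by apply/seteqP; split => [w [ib]|w [ib _]]; exists ib.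
apply: le_trans (_ : (P (~` B) <= _)%E).
  by rewrite probability_setC // EFinB leeB.
apply: le_measure; rewrite ?inE; first exact: measurableC.
  exact: measurable_num_changes_ge.
move=> w nB; apply: num_changes_ge_blocks => i b; apply/negP => Ei.
by apply: nB; exists (i, b).
Qed.

End Blocks.

End Changes.

(** * Limits *)

Section Limits.
Context {R : realType}.

Lemma cvg_one_sub_geometric (c : R) (u : nat -> nat) : u n @[n --> \oo] --> \oo ->
  (1 - c * (1 / 2) ^+ u n)%:E @[n --> \oo] --> 1%E.
Proof.
move=> hu; apply: cvg_EFin; first exact: nearW.
rewrite /comp /= [X in _ --> X](_ : _ = 1 - c * 0); last by rewrite mulr0 subr0.
apply: cvgB; first exact: cvg_cst.
apply: cvgMr; apply: (cvg_comp u (fun k => (1 / 2) ^+ k) hu).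
by apply: cvg_expr; rewrite gtr0_norm; lra.
Qed.

Lemma cvg_divn (k : nat) : (0 < k)%N -> (n %/ k)%N @[n --> \oo] --> \oo.
Proof.
move=> k0; apply/cvgnyPge => A; near=> n; rewrite leq_divRL //.
by near: n; exact: nbhs_infty_ge.
Unshelve. all: by end_near.
Qed.

(** Put [w = (1 / 2) ^+ (n %/ 16)]. Blocks of length [4 ^ (n %/ 16)], the inverse of [w ^+ 2], make
    both the diagonal and the correlation term of order [w ^+ 2]; dividing by [v >= w] leaves order
    [w]. *)
Lemma block_bound (n K : nat) (v : R) : (1 / 2) ^+ (n %/ 16) <= v ->
  2 * K%:R * (4 / v * (((4 ^ (n %/ 16))%N%:R)^-1
    + (3 / 4) ^+ n * (K * 4 ^ (n %/ 16))%N%:R))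
  <= 8 * K%:R * (1 + K%:R) * (1 / 2) ^+ (n %/ 16).
Proof.
set k := (n %/ 16)%N => hv.
have w0 : 0 < (1 / 2 : R) ^+ k by apply: exprn_gt0; lra.
have v0 : 0 < v by exact: lt_le_trans hv.
have fourE : (4 ^ k)%N%:R^-1 = (1 / 2) ^+ k * (1 / 2) ^+ k :> R.
  by rewrite natrX -exprVn -exprMn; congr (_ ^+ _); field.
have F0 : 0 < (4 ^ k)%N%:R :> R by rewrite ltr0n expn_gt0.
(* The 16 is chosen for this: [(3 / 4) ^+ 4 <= 1 / 2], so 16 levels gain a factor [(1 / 2) ^+ 4]. *)
have decay : (3 / 4) ^+ n <= ((1 / 2) ^+ k) ^+ 4 :> R.
  apply: le_trans (_ : (3 / 4) ^+ (k * 16) <= _).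
    by rewrite ler_wiXn2l ?leq_divM //; lra.
  rewrite (_ : (k * 16 = 4 * (4 * k))%N); last by rewrite mulnA mulnC.
  rewrite -exprM (exprM (3 / 4) 4) (mulnC k).
  by rewrite lerXn2r // ?nnegrE ?exprn_ge0 //; lra.
move: F0 fourE; rewrite natrM; move: ((4 ^ k)%N%:R) => F F0 FV.
move: ((1 / 2) ^+ k) hv w0 FV decay => w hv w0 FV decay.
have inner : F^-1 + (3 / 4) ^+ n * (K%:R * F) <= w ^+ 2 * (1 + K%:R).
  have -> : w ^+ 2 * (1 + K%:R) = F^-1 + w ^+ 4 * (K%:R * F).
    have Fww : F * (w * w) = 1 by rewrite -FV mulfV // lt0r_neq0.
    rewrite FV (_ : w ^+ 4 * (K%:R * F) = w ^+ 2 * K%:R * (F * (w * w))).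
      by rewrite Fww; ring.
    by ring.
  by rewrite lerD2l ler_wpM2r // mulr_ge0 // ltW.
have wv : w / v <= 1 by rewrite ler_pdivrMr // mul1r.
have K0 : 0 <= K%:R :> R by [].
apply: le_trans (_ : 2 * K%:R * (4 / v * (w ^+ 2 * (1 + K%:R))) <= _).
  by rewrite ler_wpM2l ?mulr_ge0 // ler_wpM2l // divr_ge0 // ltW.
have -> : 2 * K%:R * (4 / v * (w ^+ 2 * (1 + K%:R))) =
  8 * K%:R * (1 + K%:R) * w * (w / v) by field; rewrite lt0r_neq0.
apply: ler_piMr => //; apply: mulr_ge0; last exact: ltW.
by apply: mulr_ge0; [apply: mulr_ge0|apply: addr_ge0].
Qed.

End Limits.

Theorem theorem1p25 (R : realType) (alpha : R)
    (d : nat -> measure_display) (T : forall n, measurableType (d n))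
    (P : forall n, probability (T n) R)
    (X : forall n, leaf n -> R -> T n -> bool)
    (hX : forall n, 0 <= maj3_prob alpha n <= 1 ->
      independent_stationary_flips (P n) (maj3_prob alpha n) (X n)) :
  (alpha0 R < alpha -> lame P (fun n => num_changes (@iter_maj3 n) (X n))) /\
  (alpha < alpha0 R -> volatile P (fun n => num_changes (@iter_maj3 n) (X n))).
Proof.
split=> halpha; [|move=> M].
- have hcvg := @cvg_one_sub_geometric R 1 id cvg_id.
  apply: (squeeze_cvge _ hcvg (cvg_cst 1%E)); near=> n.
  have p_bound : 0 <= maj3_prob alpha n <= 1 / 2.
    by near: n; exact: near_maj3_prob_bound.
  have p_bound1 : 0 <= maj3_prob alpha n <= 1 by lra.
  have small : nvar (root_mean (maj3_prob alpha n) n) <= (1 / 4) ^+ n.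
    by near: n; exact: near_root_nvar_small.
  have /andP[lo ->] := no_change_prob p_bound (hX n p_bound1).
  rewrite andbT; apply: le_trans lo; rewrite lee_fin lerD2l lerN2 mul1r /=.
  rewrite (_ : (1 / 2) ^+ n = (1 / 4) ^+ n * 2 ^+ n :> R).
    by rewrite ler_wpM2r ?exprn_ge0.
  by rewrite -exprMn; congr (_ ^+ _); field.
(* Using [M + 1] blocks keeps their number positive when [M = 0]. *)
- pose c : R := 8 * M.+1%:R * (1 + M.+1%:R).
  have hcvg := cvg_one_sub_geometric c (cvg_divn (isT : (0 < 16)%N)).
  apply: (squeeze_cvge _ hcvg (cvg_cst 1%E)); near=> n.
  have p_bound : 0 <= maj3_prob alpha n <= 1 / 2.
    by near: n; exact: near_maj3_prob_bound.
  have p_bound1 : 0 <= maj3_prob alpha n <= 1 by lra.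
  have large : (1 / 2) ^+ (n %/ 16) <= nvar (root_mean (maj3_prob alpha n) n).
    by near: n; exact: near_root_nvar_large.
  have v0 : 0 < nvar (root_mean (maj3_prob alpha n) n).
    by apply: lt_le_trans large; apply: exprn_gt0; lra.
  have hn := hX n p_bound1.
  have mC k := measurable_num_changes_ge hn k.
  apply/andP; split; last exact: probability_le1.
  have m0 : (0 < 4 ^ (n %/ 16))%N by rewrite expn_gt0.
  have many := many_changes_prob p_bound hn (ltn0Sn M) m0 v0.
  apply: le_trans (le_trans many _).
    by rewrite lee_fin lerD2l lerN2; exact: block_bound.
  apply: le_measure; rewrite ?inE // => w /=; apply: le_trans.
  by rewrite lee_fin ler_nat.
Unshelve. all: by end_near.
Qed.
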